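(* Let $p \geq 2$ be an integer. Then the convergence $$\lim_{n \rightarrow \infty} \mathbb{E}T_n^p = (\mathbb{E}X^2/\mathbb{E}X)^p$$ is equivalent to the tail condition $$\mathbb{P}\{X \geq x\} = o(x^{-p-1}) \text{ as } x \rightarrow \infty.$$ Moreover, if $\mathbb{P}\{X \geq x\} = O(x^{-p-3/2})$ as $x \rightarrow \infty$, then $$\mathbb{E}T_n^p - (\mathbb{E}X^2/\mathbb{E}X)^p = O(n^{-1/2}).$$ The finiteness of the moment $\mathbb{E}X^{p+1}$ is sufficient for the convergence $\lim_{n \rightarrow \infty} \mathbb{E}T_n^p = (\mathbb{E}X^2/\mathbb{E}X)^p$ to hold, while the finiteness of the moments $\mathbb{E}X^q$ is necessary for this convergence for any real value $1 \leq q < p + 1$.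
   Context: Let $X, X_1, \dots, X_n$ be i.i.d. positive random variables with a finite second moment, and define the statistic $$T_n = \frac{X_1^2 + \dots + X_n^2}{X_1 + \dots + X_n}.$$ By the law of large numbers, with probability one $\lim_{n \rightarrow \infty} T_n^p = (\mathbb{E}X^2/\mathbb{E}X)^p$ for any $p \geq 1$; the theorem describes when this convergence also holds on average. *)

(* Defs.v *)
From HB Require Import structures.
From mathcomp Require Import all_boot all_order all_algebra.
From mathcomp Require Import all_classical all_reals all_analysis.
Set Implicit Arguments. Unset Strict Implicit. Unset Printing Implicit Defensive.
Import Order.TTheory GRing.Theory Num.Theory.
Import numFieldNormedType.Exports.
Local Open Scope classical_set_scope.
Local Open Scope ring_scope.

Definition mutually_independent d (T : measurableType d) (R : realType)
  (P : probability T R) (X : nat -> T -> R) : Prop :=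
  forall (s : seq nat) (B : nat -> set R),
    uniq s -> (forall i, measurable (B i)) ->
    P (\bigcap_(i in [set i | i \in s]) (X i @^-1` B i)) =
    (\prod_(i <- s) P (X i @^-1` B i))%E.

Definition identically_distributed d (T : measurableType d) (R : realType)
  (P : probability T R) (X : nat -> T -> R) : Prop :=
  forall n (B : set R), measurable B -> P (X n @^-1` B) = P (X 0%N @^-1` B).

Definition iid d (T : measurableType d) (R : realType)
  (P : probability T R) (X : nat -> T -> R) : Prop :=
  (forall n, measurable_fun setT (X n)) /\
  mutually_independent P X /\ identically_distributed P X.

(* T_n = (X_1^2 + ... + X_n^2) / (X_1 + ... + X_n); here the sample is
   X 0, ..., X (n-1). *)
Definition Tstat (T : Type) (R : realType) (X : nat -> T -> R) (n : nat) (w : T) : R :=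
  (\sum_(i < n) X i w ^+ 2) / (\sum_(i < n) X i w).

Definition ETp d (T : measurableType d) (R : realType) (P : probability T R)
  (X : nat -> T -> R) (p n : nat) : \bar R :=
  (\int[P]_w ((Tstat X n w) ^+ p)%:E)%E.

Definition moment d (T : measurableType d) (R : realType) (P : probability T R)
  (Y : T -> R) (q : R) : \bar R :=
  (\int[P]_w ((Y w) `^ q)%:E)%E.

(* mu = E X^2 / E X  (a real number, X having finite second moment). *)
Definition ratio_limit d (T : measurableType d) (R : realType) (P : probability T R)
  (Y : T -> R) : R :=
  fine (\int[P]_w ((Y w) ^+ 2)%:E)%E / fine (\int[P]_w (Y w)%:E)%E.

Definition tail d (T : measurableType d) (R : realType) (P : probability T R)
  (Y : T -> R) (x : R) : R :=
  fine (P [set w | x <= Y w]).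

(* Main.v *)
(** T_n <= max X_i, so the sample points above n contribute at most
    n E[X^p; X >= n] to E T_n^p.  The others enter through
    E[(sum Z_i)^p g(sum X_i)], with Z_i = X_i^2 1(X_i < n) and g(s) a
    truncation of s^-p.  Since g is nonincreasing, leaving one index out can
    only increase it, and expanding the p-th power one factor at a time bounds
    this by moments of Z and by E g(sum X_i): numerator and denominator
    decouple, and the denominator needs only second moments and a Chernoff
    bound.  The moments of Z are estimated dyadically from the tail of X.

    Conversely, the tangent lines of x^p at mu = E X^2 / E X and of 1/b at E X
    bound T_n^p from below by a polynomial of degree two in the sample, whose
    expectation involves only pairs of indices.  When exactly one X_i exceeds
    n, T_n is of order n, which adds a multiple of n^(p+1) P(X >= n) to this
    lower bound.  *)

Require Import Defs.
From HB Require Import structures.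
From mathcomp Require Import all_boot all_order all_algebra.
From mathcomp Require Import all_classical all_reals all_analysis.
From mathcomp Require Import measurable_realfun ring lra.
Import Order.TTheory GRing.Theory Num.Theory.
Import numFieldNormedType.Exports.
Set Implicit Arguments. Unset Strict Implicit. Unset Printing Implicit Defensive.
Local Open Scope classical_set_scope.
Local Open Scope ring_scope.

(** * Independence *)

Section Independence.
Context (d : measure_display) (T : measurableType d) (R : realType).
Variable P : probability T R.

(** The cut at n is dictated by scale: one value above n makes T_n of order n, so such jumps carry
    about n * n^p * P(X >= n), the very quantity of the tail condition. Only a second moment is
    given, so E X^3 may be infinite, although a quadratic lower bound has diagonal terms of that
    kind; hence x^2 is replaced there by a minorant [kap], a bounded truncation for convergence and
    x^2 itself for the rate, where the tail supplies a third moment. The tangent term and the jump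
    term have to be gained on the same event: T_n^(p-1) is then so large that half of T_n^p pays for
    each. One upper bound, for tails at most eta * x^(-p-1-sig), serves both claims: sig = 0 with
    eta small gives convergence, sig = 1/2 with eta fixed gives the rate. Expectations are
    extended-real integrals of nonnegative functions, so inequalities are arranged with all terms
    positive under the integral, and integrability need not be known beforehand. *)

Definition Ex (f : T -> R) : \bar R := (\int[P]_w (f w)%:E)%E.

Section Pair.
Context (d1 d2 : measure_display) (T1 : measurableType d1) (T2 : measurableType d2).
Variables (V : T -> T1) (W : T -> T2).
Hypotheses (mV : measurable_fun setT V) (mW : measurable_fun setT W).

Definition indep2 : Prop := forall A B, measurable A -> measurable B ->
  P (V @^-1` A `&` W @^-1` B) = (P (V @^-1` A) * P (W @^-1` B))%E.

Let mVW : measurable_fun setT (fun w => (V w, W w)).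
Proof. exact: measurable_fun_pair. Qed.

(** Both sides are finite measures in C, the image of P restricted to E and the image of P scaled by
    P E. They agree on rectangles, which are stable under intersection and generate the product
    sigma-algebra. *)
Lemma indep_of_rectangles (E : set T) : measurable E ->
  (forall A B, measurable A -> measurable B ->
     P (V @^-1` A `&` W @^-1` B `&` E) = (P (V @^-1` A `&` W @^-1` B) * P E)%E) ->
  forall C : set (T1 * T2), measurable C ->
  P ((fun w => (V w, W w)) @^-1` C `&` E)
  = (P ((fun w => (V w, W w)) @^-1` C) * P E)%E.
Proof.
move=> mE rectE.
pose phi := fun w => (V w, W w).
have PE0 : (0 <= fine (P E))%R by rewrite fine_ge0.
pose r : {nonneg R} := NngNum PE0.
have rE : r%:num%:E = P E by rewrite /= fineK// fin_num_measure.
pose m1 : measure (T1 * T2)%type R := pushforward (mrestr P mE) phi.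
pose m2 : measure (T1 * T2)%type R := mscale r (pushforward P phi).
move=> C mC.
suff : m1 mVW C = m2 mVW C by rewrite /m1 /m2 /= /mscale rE muleC.
apply: (measure_unique [set A `*` B | A in measurable & B in measurable]
  (fun=> setT)) => //.
- exact: measurable_prod_measurableType.
- move=> _ _ [A1 mA1 [B1 mB1 <-]] [A2 mA2 [B2 mB2 <-]].
  exists (A1 `&` A2); first exact: measurableI.
  by exists (B1 `&` B2); [exact: measurableI|rewrite setXI].
- by move=> _; exists setT => //; exists setT => //; rewrite setXTT.
- by rewrite bigcup_const//; exists 0%N.
- move=> _ [A mA [B mB <-]]; have := rectE A B mA mB.
  by rewrite /m1 /m2 /= /mscale rE muleC.
- move=> k; apply: (le_lt_trans (probability_le1 P _)); last by rewrite ltry.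
  by rewrite preimage_setT setTI.
Qed.

(** By uniqueness on rectangles the joint law is the product of the marginal laws, and Tonelli
    separates the integrals; nonnegativity replaces integrability. *)
Lemma indep_expectation (f : T1 -> R) (g : T2 -> R) : indep2 ->
  measurable_fun setT f -> measurable_fun setT g ->
  (forall x, 0 <= f x) -> (forall x, 0 <= g x) ->
  Ex (fun w => f (V w) * g (W w)) = (Ex (f \o V) * Ex (g \o W))%E.
Proof.
move=> iVW mf mg f0 g0.
pose phi := fun w => (V w, W w).
pose phip : {mfun T >-> (T1 * T2)%type} :=
  HB.pack phi (isMeasurableFun.Build _ _ _ _ phi mVW).
pose Vp : {mfun T >-> T1} := HB.pack V (isMeasurableFun.Build _ _ _ _ V mV).
pose Wp : {mfun T >-> T2} := HB.pack W (isMeasurableFun.Build _ _ _ _ W mW).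
pose h : T1 * T2 -> \bar R := fun z => (f z.1 * g z.2)%:E.
have mh : measurable_fun setT h.
  by apply/measurable_EFinP/measurable_funM; exact: measurableT_comp.
have h0 z : (0 <= h z)%E by rewrite lee_fin mulr_ge0.
transitivity (\int[distribution P phip]_z h z)%E.
  by rewrite ge0_integral_distribution.
rewrite (eq_measure_integral (distribution P Vp \x distribution P Wp)%E); last first.
  move=> C mC _; apply/esym.
  apply: (@product_measure_unique _ _ _ _ _ (distribution P Vp) (distribution P Wp)
    (distribution P phip)) => [A B mA mB|//].
  exact: (iVW A B mA mB).
transitivity (\int[distribution P Vp]_x fubini_F (distribution P Wp) h x)%E.
  exact: fubini_tonelli1.
rewrite /fubini_F /h /=.
under eq_integral => x _.
  under eq_integral do rewrite EFinM.
  rewrite ge0_integralZl//; last 3 first.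
  - exact/measurable_EFinP.
  - by move=> y _; rewrite lee_fin.
  - by rewrite lee_fin.
  rewrite muleC.
  over.
rewrite ge0_integralZl//; last 3 first.
- exact/measurable_EFinP.
- by move=> y _; rewrite lee_fin.
- by apply: integral_ge0 => y _; rewrite lee_fin.
rewrite muleC; congr (_ * _)%E.
- by rewrite ge0_integral_distribution//; exact/measurable_EFinP.
- by rewrite ge0_integral_distribution//; exact/measurable_EFinP.
Qed.

End Pair.

(** * One variable against sums over the other indices *)

Section Sequence.
Variable X : nat -> T -> R.
Hypothesis iidX : iid P X.

Lemma expectation_same_law (f : R -> R) i :
  measurable_fun setT f -> (forall x, 0 <= f x) ->
  Ex (fun w => f (X i w)) = Ex (fun w => f (X 0%N w)).
Proof.
move=> mf f0; have [mX [_ idX]] := iidX.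
pose Xp i : {mfun T >-> R} := HB.pack (X i) (isMeasurableFun.Build _ _ _ _ (X i) (mX i)).
have E j : Ex (fun w => f (X j w)) = (\int[distribution P (Xp j)]_y (f y)%:E)%E.
  by rewrite ge0_integral_distribution//; exact/measurable_EFinP.
rewrite !E; apply: eq_measure_integral => A mA _.
exact: idX.
Qed.

(** The two sums are kept as one pair because independence is needed jointly for numerator and
    denominator: [z] is the summand of the numerator. *)
Definition sums (z : R -> R) (I : seq nat) (w : T) : R * R :=
  (\sum_(j <- I) X j w, \sum_(j <- I) z (X j w)).

Section Sums.
Variable z : R -> R.
Hypothesis mz : measurable_fun setT z.

Lemma measurable_sums I : measurable_fun setT (sums z I).
Proof.
have [mX _] := iidX.
apply: measurable_fun_pair; apply: measurable_sum => // i.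
by apply: measurableT_comp => //; exact: mX.
Qed.

Let cap (s : seq nat) (B : nat -> set R) :=
  \bigcap_(i in [set i | i \in s]) (X i @^-1` B i).

Let measurable_cap s B : (forall i, measurable (B i)) -> measurable (cap s B).
Proof.
move=> mB; have [mX _] := iidX.
apply: fin_bigcap_measurable; first exact: finite_seq.
by move=> i _; rewrite -[X in measurable X]setTI; exact: mX.
Qed.

Let cap_cons k s B : cap (k :: s) B = X k @^-1` B k `&` cap s B.
Proof.
apply/seteqP; split => [w H|w [Hk Hs] i].
  split; first by apply: H; rewrite /= inE eqxx.
  by move=> i /= si; apply: H; rewrite /= inE si orbT.
by rewrite /= inE => /orP[/eqP ->//|/Hs].
Qed.

(** Induction on I with s general: the head k is moved from I to s. The sums over k :: I are a
    function of the pair (sums over I, X k), so only rectangles in that pair need checking, and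
    there the event on X k joins those indexed by s. *)
Let sums_indep I s B (C : set (R * R)) : uniq (I ++ s) ->
  (forall i, measurable (B i)) -> measurable C ->
  P (sums z I @^-1` C `&` cap s B)
  = (P (sums z I @^-1` C) * \prod_(i <- s) P (X i @^-1` B i))%E.
Proof.
have [mX [indX _]] := iidX.
elim: I s B C => [|k I IH] s B C /=.
  move=> us mB mC.
  have -> : sums z [::] = fun=> (0, 0).
    by apply/funext => w; rewrite /sums !big_nil.
  have [C0|C0] := pselect (C (0, 0)).
    have -> : (fun=> (0, 0)) @^-1` C = [set: T] by apply/seteqP; split.
    by rewrite setTI probability_setT mul1e; exact: indX.
  have -> : (fun=> (0, 0)) @^-1` C = set0 :> set T by apply/seteqP; split.
  by rewrite set0I measure0 mul0e.
move=> /andP[kIs uIs] mB mC.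
have uIks : uniq (I ++ k :: s).
  by rewrite -(perm_uniq (permEl (perm_catCA [:: k] I s))) /= kIs.
have PE : P (cap s B) = (\prod_(i <- s) P (X i @^-1` B i))%E.
  by have := IH s B setT uIs mB measurableT; rewrite preimage_setT setTI probability_setT mul1e.
have uIk : uniq (I ++ [:: k]).
  by move: uIks; rewrite -cat1s catA cat_uniq => /andP[].
have two A D : measurable A -> measurable D ->
    P (sums z I @^-1` A `&` X k @^-1` D) = (P (sums z I @^-1` A) * P (X k @^-1` D))%E.
  move=> mA mD; have := IH [:: k] (fun=> D) A uIk (fun=> mD) mA.
  have -> : cap [:: k] (fun=> D) = X k @^-1` D.
    by rewrite cap_cons; apply/seteqP; split => [w []//|w Dw]; split.
  by rewrite big_seq1.
pose F (u : (R * R) * R) := (u.2 + u.1.1, z u.2 + u.1.2).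
have mF : measurable_fun setT F.
  apply: measurable_fun_pair; apply: measurable_funD.
  - exact: measurable_snd.
  - exact: (measurableT_comp measurable_fst measurable_fst).
  - by apply: measurableT_comp.
  - exact: (measurableT_comp measurable_snd measurable_fst).
have -> : sums z (k :: I) = F \o (fun w => (sums z I w, X k w)).
  by apply/funext => w; rewrite /sums /F /= !big_cons.
rewrite comp_preimage -PE.
apply: indep_of_rectangles => //.
- exact: measurable_sums.
- exact: measurable_cap.
- move=> A D mA mD.
  (* The event D for X k is stored at index k of the family; k is not in s, so the other events are
     unchanged. *)
  pose B' i := if i == k then D else B i.
  have mB' i : measurable (B' i) by rewrite /B'; case: ifP.
  have capB' : cap s B = cap s B'.
    apply: eq_bigcapr => i /= si; rewrite /B'; case: eqP => // ik.
    by move: kIs; rewrite -ik mem_cat si orbT.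
  have := IH (k :: s) B' A uIks mB' mA.
  rewrite cap_cons setIA /B' eqxx big_cons -/B' -capB' => ->.
  rewrite two// -muleA PE; congr (_ * (_ * _))%E; first by rewrite eqxx.
  rewrite !big_seq; apply: eq_bigr => i si; rewrite /B'; case: eqP => // ik.
  by move: kIs; rewrite -ik mem_cat si orbT.
- by rewrite -[X in measurable X]setTI; exact: mF.
Qed.

Lemma expectation_leave_one_out (f : R -> R) (g : R * R -> R) i I :
  uniq (i :: I) -> measurable_fun setT f -> measurable_fun setT g ->
  (forall x, 0 <= f x) -> (forall x, 0 <= g x) ->
  Ex (fun w => f (X i w) * g (sums z I w))
  = (Ex (fun w => f (X 0%N w)) * Ex (fun w => g (sums z I w)))%E.
Proof.
move=> uiI mf mg f0 g0; have [mX _] := iidX.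
rewrite -(expectation_same_law i)//.
apply: (indep_expectation (mX i) (measurable_sums I)) => //.
move=> A B mA mB.
have uI : uniq (I ++ [:: i]) by rewrite cats1 rcons_uniq; move: uiI => /=.
have := sums_indep uI (fun=> mA) mB.
have -> : cap [:: i] (fun=> A) = X i @^-1` A.
  by rewrite cap_cons; apply/seteqP; split => [w []//|w Dw]; split.
by rewrite big_seq1 setIC muleC.
Qed.

End Sums.

Lemma expectation_pair (f g : R -> R) i j : i != j ->
  measurable_fun setT f -> measurable_fun setT g ->
  (forall x, 0 <= f x) -> (forall x, 0 <= g x) ->
  Ex (fun w => f (X i w) * g (X j w))
  = (Ex (fun w => f (X 0%N w)) * Ex (fun w => g (X 0%N w)))%E.
Proof.
move=> ij mf mg f0 g0.
have uij : uniq [:: i; j] by rewrite /= inE ij.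
have mg1 : measurable_fun setT (fun u : R * R => g u.1).
  by apply: measurableT_comp => //; exact: measurable_fst.
have sumsE w : X j w = (sums id [:: j] w).1 by rewrite /= big_seq1.
transitivity (Ex (fun w => f (X i w) * g (sums id [:: j] w).1)).
  by congr Ex; apply/funext => w; rewrite -sumsE.
rewrite (expectation_leave_one_out (@measurable_id _ _ _) uij mf mg1 f0 (fun u => g0 u.1)); congr (_ * _)%E.
by rewrite -(expectation_same_law j mg g0); congr Ex; apply/funext => w; rewrite -sumsE.
Qed.

End Sequence.
End Independence.

Arguments Ex {d T R} P f%_ring_scope.

(** * Elementary inequalities *)

Section RealInequalities.
Context (R : realType).
Implicit Types (x y u w : R) (p n k : nat).

(** The tangent line of x^(p+1) at w lies below the curve. Multiplying the induction hypothesis by x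
    leaves the square (p+1) w^p (x - w)^2. *)
Lemma exprn_tangent x w p : 0 <= x -> 0 <= w ->
  p.+1%:R * w ^+ p * x <= x ^+ p.+1 + p%:R * w ^+ p.+1.
Proof.
move=> x0 w0; elim: p => [|p IH]; first by rewrite expr0 expr1 !mul1r mul0r addr0.
have := ler_wpM2l x0 IH.
have q0 : 0 <= p.+1%:R * w ^+ p * (x - w) ^+ 2.
  by rewrite mulr_ge0 ?sqr_ge0// mulr_ge0 ?exprn_ge0//.
move: q0; rewrite -!natr1 !exprS expr0 => q0 H; nra.
Qed.

(** A tangent at 1 with quadratic error for w^-p, made possible near 0 by the cut at 1/2. For u with
    mean near 1 and variance O(1/n), it yields the mean of the truncated u^-p up to O(1/n) from
    second moments alone. *)
Lemma inv_max_exprn_quadratic p : exists2 K : R, 0 <= K & forall u, 0 <= u ->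
  (Num.max u 2^-1)^-1 ^+ p + p%:R * u <= 1 + p%:R + K * (u - 1) ^+ 2.
Proof.
have [K K0 HK] : exists2 K : R, 0 <= K & forall w, 2^-1 <= w ->
    w^-1 ^+ p + p%:R * w <= 1 + p%:R + K * (w - 1) ^+ 2.
  elim: p => [|p [K K0 IH]].
    by exists 0 => // w _; rewrite expr0 mulr0n !mul0r !addr0.
  (* The induction hypothesis is multiplied by y = 1/w <= 2, which doubles K; the factor y of 1 + p
     is then replaced by 2 - w + 2 (w - 1)^2. *)
  exists (2 * K + 2 * (1 + p%:R)); first by rewrite addr_ge0// mulr_ge0// addr_ge0.
  move=> w hw; have w0 : 0 < w by rewrite (lt_le_trans _ hw).
  have y0 : 0 < w^-1 by rewrite invr_gt0.
  have y2 : w^-1 <= 2 by rewrite -[2]invrK lef_pV2// posrE.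
  have wy : w * w^-1 = 1 by rewrite divff// gt_eqF.
  have := ler_wpM2l (ltW y0) (IH w hw).
  set y := w^-1 in y0 y2 wy *; rewrite (exprS y p); set z := y ^+ p.
  have y1 : y <= 2 - w + 2 * (w - 1) ^+ 2.
    have -> : y = 2 - w + y * (w - 1) ^+ 2.
      have -> : y * (w - 1) ^+ 2 = w * (w * y) - 2 * (w * y) + y by ring.
      by rewrite wy; ring.
    by rewrite lerD2l ler_wpM2r// sqr_ge0.
  have K1 : y * (K * (w - 1) ^+ 2) <= 2 * (K * (w - 1) ^+ 2).
    by rewrite ler_wpM2r// mulr_ge0// sqr_ge0.
  have := ler_wpM2l (ler0n R p.+1) y1.
  have pw : y * (p%:R * w) = p%:R by rewrite mulrCA [y * w]mulrC wy mulr1.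
  have pE : p.+1%:R = p%:R + 1 :> R by rewrite natr1.
  rewrite pE => H2; rewrite !(mulrDr y) pw mulr1 => H1.
  move: (p%:R : R) (y * z) ((w - 1) ^+ 2) H1 H2 K1 => q yz t H1 H2 K1.
  clear -H1 H2 K1; clearbody y.
  lra.
exists K => // u u0; have [uh|uh] := leP 2^-1 u; first exact: HK.
(* Below 1/2 the maximum is constant and the linear term is at most its value at 1/2, while (u -
   1)^2 is at least its value there. *)
apply: (@le_trans _ _ (2^-1^-1 ^+ p + p%:R * 2^-1)); first by rewrite lerD2l ler_wpM2l// ltW.
apply: (le_trans (HK _ (lexx _))); rewrite lerD2l ler_wpM2l// !expr2; nra.
Qed.

(** Passing through 1 / (1 + x) suffices. This turns a second moment of a positive variable into a
    bound on its Laplace transform. *)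
Lemma expRN_quadratic x : 0 <= x -> expR (- x) <= 1 - x + x ^+ 2.
Proof.
move=> x0; rewrite expRN.
have x1 : 0 < 1 + x by rewrite ltr_pwDl.
apply: (@le_trans _ _ (1 + x)^-1); first by rewrite lef_pV2 ?posrE ?expR_gt0 ?expR_ge1Dx.
rewrite -[_^-1]mul1r ler_pdivrMr// !expr2.
have : 0 <= x * x * x by rewrite !mulr_ge0.
nra.
Qed.

(** One term of the exponential series, that of degree p + 1, already beats n^p with a factor n to
    spare; it gives the constant. *)
Lemma exprn_expR_decay (c : R) p : 0 < c ->
  exists2 C : R, 0 <= C & forall n, (0 < n)%N -> n%:R ^+ p * expR (- (c * n%:R)) <= C / n%:R.
Proof.
move=> c0; exists (p.+1`!%:R / c ^+ p.+1); first by rewrite divr_ge0// exprn_ge0// ltW.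
move=> n n0; have n0' : 0 < n%:R :> R by rewrite ltr0n.
rewrite expRN ler_pdivlMr// mulrAC -exprSr ler_pdivrMr ?expR_gt0//.
rewrite mulrAC ler_pdivlMr ?exprn_gt0// mulrC -exprMn.
rewrite -ler_pdivrMl ?ltr0n ?fact_gt0// mulrC.
have := @expR_ge1Dxn R (c * n%:R) p (mulr_ge0 (ltW c0) (ltW n0')).
lra.
Qed.

(** Used to reduce all intermediate moments of the truncated squares to the two extreme ones. *)
Lemma exprn_le_interpolate x k m : 0 <= x -> (0 < k <= m)%N -> x ^+ k <= x + x ^+ m.
Proof.
move=> x0 /andP[k0 km]; have [x1|x1] := leP x 1.
  apply: (@le_trans _ _ x); last by rewrite lerDl exprn_ge0.
  by rewrite -[leRHS]expr1; apply: ler_wiXn2l.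
apply: (@le_trans _ _ (x ^+ m)); last by rewrite lerDr.
by rewrite ler_eXn2l.
Qed.

End RealInequalities.

(** * Moments of iid sums *)

Section ExpectationToolkit.
Context (d : measure_display) (T : measurableType d) (R : realType).
Variable P : probability T R.
Implicit Types f g : T -> R.

Lemma Ex_ge0 f : (forall w, 0 <= f w) -> (0 <= Ex P f)%E.
Proof. by move=> f0; apply: integral_ge0 => w _; rewrite lee_fin. Qed.

Lemma Ex_le f g : measurable_fun setT f -> measurable_fun setT g ->
  (forall w, 0 <= f w) -> (forall w, f w <= g w) -> (Ex P f <= Ex P g)%E.
Proof.
move=> mf mg f0 fg; apply: ge0_le_integral => //.
- by move=> w _; rewrite lee_fin.
- exact/measurable_EFinP.
- exact/measurable_EFinP.
- by move=> w _; rewrite lee_fin.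
Qed.

Lemma ExD f g : measurable_fun setT f -> measurable_fun setT g ->
  (forall w, 0 <= f w) -> (forall w, 0 <= g w) ->
  Ex P (fun w => (f w + g w)%R) = (Ex P f + Ex P g)%E.
Proof.
move=> mf mg f0 g0; rewrite /Ex -ge0_integralD//.
- by move=> w _; rewrite lee_fin.
- exact/measurable_EFinP.
- by move=> w _; rewrite lee_fin.
- exact/measurable_EFinP.
Qed.

Lemma ExZ f (k : R) : measurable_fun setT f -> (forall w, 0 <= f w) -> 0 <= k ->
  Ex P (fun w => (k * f w)%R) = (k%:E * Ex P f)%E.
Proof.
move=> mf f0 k0; rewrite /Ex -ge0_integralZl_EFin//.
- by move=> w _; rewrite lee_fin.
- exact/measurable_EFinP.
Qed.

Lemma Ex_sum (I : Type) (F : I -> T -> R) (s : seq I) :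
  (forall i, measurable_fun setT (F i)) -> (forall i w, 0 <= F i w) ->
  Ex P (fun w => (\sum_(i <- s) F i w)%R) = (\sum_(i <- s) Ex P (F i))%E.
Proof.
move=> mF F0; rewrite /Ex -ge0_integral_sum//.
- by apply: eq_integral => w _; rewrite sumEFin.
- by move=> i; exact/measurable_EFinP.
- by move=> i w _; rewrite lee_fin.
Qed.

Lemma Ex_cst (c : R) : Ex P (fun=> c) = c%:E.
Proof. by rewrite /Ex integral_cst//= probability_setT mule1. Qed.

Lemma eq_Ex f g : f =1 g -> Ex P f = Ex P g.
Proof. by move=> fg; congr (Ex P _); exact/funext. Qed.

Lemma measurable_fun_bool_natmul (b : T -> bool) : measurable_fun setT b ->
  measurable_fun setT (fun w => (b w)%:R : R).
Proof.
move=> mb.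
have -> : (fun w => (b w)%:R : R) = \1_(b @^-1` [set true]).
  apply/funext => w; rewrite indicE; congr ((nat_of_bool _)%:R).
  by apply/idP/idP => [bw|/set_mem]; [exact/mem_set|].
by apply: measurable_indic; rewrite -[X in measurable X]setTI; exact: mb.
Qed.

End ExpectationToolkit.

(** * Decoupling numerator and denominator by leaving one index out *)

Section IidSums.
Context (d : measure_display) (T : measurableType d) (R : realType).
Variable P : probability T R.
Variables (X : nat -> T -> R).
Hypotheses (iidX : iid P X) (X_gt0 : forall n w, 0 < X n w).

Let mX i : measurable_fun setT (X i). Proof. by have [] := iidX. Qed.

Let mS z I : measurable_fun setT z -> measurable_fun setT (fun w => (sums X z I w).2).
Proof.
by move=> mz; apply: (measurableT_comp measurable_snd); apply: (measurable_sums iidX).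
Qed.

Let mS1 I : measurable_fun setT (fun w => \sum_(j <- I) X j w).
Proof. by apply: measurable_sum => i. Qed.

(* Write the last factor of the power as a sum over [i], expand the others around
   the sum without [i], and drop [X i] from the argument of [g]. *)
Lemma moment_recursion (v : R) p q : 0 <= v -> (q <= p)%N ->
  exists2 C : R, 0 <= C & forall n (e b : R) (z g : R -> R),
    0 <= e <= 1 -> 0 <= b ->
    measurable_fun setT z -> measurable_fun setT g ->
    (forall x, 0 <= z x) -> (forall x, 0 <= g x) ->
    {homo g : x y /~ x <= y} ->
    (Ex P (fun w => (z (X 0%N w))%R) <= v%:E)%E ->
    (forall k, (0 < k < p)%N ->
       (Ex P (fun w => (z (X 0%N w) ^+ k.+1)%R) <= (e * n%:R ^+ k)%:E)%E) ->
    (forall I, uniq I -> (n <= size I + p)%N -> (size I <= n)%N ->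
       (Ex P (fun w => (g (\sum_(j <- I) X j w))%R) <= b%:E)%E) ->
    forall j I, (j <= q)%N -> uniq I -> (n + j <= size I + p)%N -> (size I <= n)%N ->
    (Ex P (fun w => ((sums X z I w).2 ^+ j * g (\sum_(k <- I) X k w))%R)
      <= (n%:R ^+ j * (v ^+ j + C * e) * b)%:E)%E.
Proof.
move=> v0; elim: q => [_|q IH qp].
  exists 0 => // n e b z g _ b0 mz mg z0 g0 _ _ _ base j I.
  rewrite leqn0 => /eqP -> uI; rewrite addn0 => nI In.
  rewrite !expr0 mul0r addr0 !mul1r; apply: le_trans (base I uI nI In).
  by rewrite le_eqVlt; apply/orP; left; apply/eqP/eq_Ex => w; rewrite expr0 mul1r.
have [C C0 HC] := IH (ltnW qp).
pose D := \sum_(k < q) 'C(q, k.+1)%:R * (v ^+ (q - k.+1) + C).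
have D0 : 0 <= D by apply: sumr_ge0 => k _; rewrite mulr_ge0// addr_ge0// exprn_ge0.
(* [C] serves the exponents j <= q. In the expansion for q + 1, the term k = 0 has the mean v as
   factor and gives [v * C]; the terms k > 0 each carry a factor e and are collected in [D], where
   the inner e is bounded by 1. *)
exists (C + v * C + D); first by rewrite !addr_ge0// mulr_ge0.
move=> n e b z g /andP[e0 e1] b0 mz mg z0 g0 gmon Hz Hzk base j I jq uI nI In.
have {}HC := HC n e b z g _ b0 mz mg z0 g0 gmon Hz Hzk base.
have Sz0 J w : 0 <= (sums X z J w).2 by apply: sumr_ge0 => i _.
have [jq'|] := leqP j q.
  apply: le_trans (HC _ j I jq' uI nI In) _; first by rewrite e0.
  rewrite lee_fin ler_wpM2r// ler_wpM2l ?exprn_ge0// lerD2l ler_wpM2r//.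
  by rewrite -addrA lerDl addr_ge0// mulr_ge0.
move=> qj; have jE : j = q.+1 by apply/eqP; rewrite eqn_leq jq qj.
move: nI; rewrite {j jq qj}jE => nI.
pose F i k w := 'C(q, k)%:R * (z (X i w) ^+ k.+1 *
   ((sums X z (rem i I) w).2 ^+ (q - k) * g (\sum_(j <- rem i I) X j w))).
have mF i k : measurable_fun setT (F i k).
  apply: measurable_funM => //; apply: measurable_funM.
    by apply: measurable_funX; exact: measurableT_comp.
  apply: measurable_funM; first by apply: measurable_funX; exact: mS.
  exact: measurableT_comp.
have F0 i k w : 0 <= F i k w by rewrite !mulr_ge0// exprn_ge0.
pose zb k := if k == 0%N then v else e * n%:R ^+ k.
have zb0 k : 0 <= zb k by rewrite /zb; case: eqP => // _; rewrite mulr_ge0// exprn_ge0.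
pose B k := 'C(q, k)%:R * (zb k * (n%:R ^+ (q - k) * (v ^+ (q - k) + C * e) * b)).
have B0 k : 0 <= B k.
  by rewrite /B mulr_ge0// mulr_ge0// mulr_ge0// mulr_ge0// ?exprn_ge0// addr_ge0 ?exprn_ge0// mulr_ge0.
apply: (@le_trans _ _ (Ex P (fun w => (\sum_(i <- I) \sum_(k < q.+1) F i k w)%R))).
  apply: Ex_le.
  - by apply: measurable_funM; [apply: measurable_funX; exact: mS|exact: measurableT_comp].
  - by apply: measurable_sum => i; apply: measurable_sum => k.
  - by move=> w; rewrite mulr_ge0// exprn_ge0.
  - move=> w; rewrite exprSr -mulrA.
    have S2E : (sums X z I w).2 = \sum_(i <- I) z (X i w) by [].
    rewrite [X in _ * (X * _)]S2E mulr_suml mulr_sumr.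
    rewrite big_seq [leRHS]big_seq; apply: ler_sum => i iI.
    have SE : (sums X z I w).2 = (sums X z (rem i I) w).2 + z (X i w).
      by rewrite /sums /= (perm_big _ (perm_to_rem iI)) big_cons addrC.
    have gle : g (\sum_(k <- I) X k w) <= g (\sum_(j <- rem i I) X j w).
      by apply: gmon; rewrite (perm_big _ (perm_to_rem iI)) big_cons lerDr ltW.
    rewrite mulrA; apply: (le_trans (ler_wpM2l _ gle)).
      by rewrite !mulr_ge0// exprn_ge0.
    rewrite SE exprDn !mulr_suml le_eqVlt; apply/orP; left; apply/eqP.
    apply: eq_bigr => k _; rewrite /F -mulr_natr exprS; ring.
rewrite Ex_sum; last 2 first.
- by move=> i; apply: measurable_sum => k.
- by move=> i w; apply: sumr_ge0.
apply: (@le_trans _ _ (\sum_(i <- I) (\sum_(k < q.+1) B k)%:E)%E).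
  rewrite big_seq [leRHS]big_seq; apply: lee_sum => i iI.
  rewrite Ex_sum// -sumEFin; apply: lee_sum => k _.
  rewrite /F ExZ//; last 2 first.
  - apply: measurable_funM; first by apply: measurable_funX; exact: measurableT_comp.
    apply: measurable_funM; first by apply: measurable_funX; exact: mS.
    exact: measurableT_comp.
  - by move=> w; rewrite !mulr_ge0// exprn_ge0.
  rewrite /B EFinM; apply: lee_wpmul2l; first by rewrite lee_fin.
  have uiI : uniq (i :: rem i I) by rewrite -(perm_uniq (perm_to_rem iI)).
  (* Factorisation asks for a function nonnegative on all pairs; the absolute value changes nothing
     along the actual sums. *)
  pose G (u : R * R) := (`|u.2| ^+ (q - k) * g u.1).
  have mG : measurable_fun setT G.
    apply: measurable_funM; last by apply: measurableT_comp => //; exact: measurable_fst.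
    by apply: measurable_funX; apply: measurableT_comp => //; exact: measurable_snd.
  have G0 u : 0 <= G u by rewrite mulr_ge0// exprn_ge0.
  have zk0 x : 0 <= z x ^+ k.+1 by rewrite exprn_ge0.
  have mzk : measurable_fun setT (fun x => z x ^+ k.+1) by exact: measurable_funX.
  have GE : (fun w => G (sums X z (rem i I) w)) =
      (fun w => (sums X z (rem i I) w).2 ^+ (q - k) * g (\sum_(j <- rem i I) X j w)).
    by apply/funext => w; rewrite /G ger0_norm.
  have := expectation_leave_one_out iidX mz uiI mzk mG zk0 G0.
  rewrite GE => H.
  have -> : Ex P (fun w => (z (X i w) ^+ k.+1 *
     ((sums X z (rem i I) w).2 ^+ (q - k) * g (\sum_(j <- rem i I) X j w)))%R) =
     Ex P (fun w => (z (X i w) ^+ k.+1 * G (sums X z (rem i I) w))%R).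
    by apply: eq_Ex => w; rewrite /G ger0_norm.
  rewrite H EFinM; apply: lee_pmul.
  - by apply: Ex_ge0 => w.
  - by apply: Ex_ge0 => w; rewrite mulr_ge0// exprn_ge0.
  - rewrite /zb; case: eqP => [->|/eqP k0]; first exact: Hz.
    apply: Hzk; rewrite lt0n k0/=.
    by apply: leq_trans (ltn_ord k) _.
  (* Removing i costs one index while the exponent drops by at least one, so n + j <= size I + p
     persists: at most p indices are ever lost. *)
  - apply: HC; rewrite ?e0 ?leq_subr//.
    + by move: uiI => /= /andP[].
    + rewrite size_rem//.
      have I0 : (0 < size I)%N by case: (I) iI.
      move: nI; rewrite -{1}(prednK I0) addSn addnS ltnS; apply: leq_trans.
      by rewrite leq_add2l leq_subr.
    + by rewrite size_rem// (leq_trans (leq_pred _)).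
rewrite sumEFin lee_fin big_const_seq count_predT iter_addr addr0.
apply: (@le_trans _ _ (n%:R * \sum_(k < q.+1) B k)).
  rewrite -[_ *+ size I]mulr_natl ler_wpM2r ?ler_nat//.
  by apply: sumr_ge0.
rewrite big_ord_recl /= /B bin0 mul1r subn0 {1}/zb eqxx.
have -> : \sum_(i < q) 'C(q, bump 0 i)%:R * (zb (bump 0 i) * (n%:R ^+ (q - bump 0 i) *
    (v ^+ (q - bump 0 i) + C * e) * b)) =
    n%:R ^+ q * e * b * \sum_(i < q) 'C(q, i.+1)%:R * (v ^+ (q - i.+1) + C * e).
  rewrite mulr_sumr; apply: eq_bigr => i _; rewrite /bump /= add1n /zb /=.
  have -> : n%:R ^+ q = n%:R ^+ i.+1 * n%:R ^+ (q - i.+1) :> R.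
    by rewrite -exprD subnKC.
  by move: (n%:R ^+ i.+1 : R) (n%:R ^+ (q - i.+1) : R) => *; ring.
have DD : \sum_(i < q) 'C(q, i.+1)%:R * (v ^+ (q - i.+1) + C * e) <= D.
  by apply: ler_sum => i _; rewrite ler_wpM2l// lerD2l ler_piMr.
have nq0 : 0 <= n%:R ^+ q :> R by rewrite exprn_ge0.
have -> : n%:R ^+ q.+1 * (v ^+ q.+1 + (C + v * C + D) * e) * b =
  n%:R * (v * (n%:R ^+ q * (v ^+ q + C * e) * b) + n%:R ^+ q * e * b * D)
  + n%:R * n%:R ^+ q * (C * e) * b by rewrite !exprS; ring.
apply: (@le_trans _ _ (n%:R * (v * (n%:R ^+ q * (v ^+ q + C * e) * b) + n%:R ^+ q * e * b * D))).
  by rewrite ler_wpM2l// lerD2l ler_wpM2l// !mulr_ge0.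
by rewrite lerDl !mulr_ge0.
Qed.

End IidSums.

(** * Upper bound *)

Section UpperPointwise.
Context (R : realType).
Implicit Types (x : nat -> R) (I : seq nat).

Lemma seq_argmax x I : I != [::] ->
  exists2 i, i \in I & forall j, j \in I -> x j <= x i.
Proof.
elim: I => // i [|k I] IH _.
  by exists i; rewrite ?mem_head// => j; rewrite inE => /eqP ->.
have [//|a aI ale] := IH _.
have [ia|ai] := leP (x i) (x a).
  exists a; first by rewrite inE aI orbT.
  by move=> j; rewrite inE => /orP[/eqP ->//|/ale].
exists i; first exact: mem_head.
by move=> j; rewrite inE => /orP[/eqP ->//|/ale /le_trans]; apply; exact: ltW.
Qed.

(** Each case is paid for by one summand. If the largest x_i is at least N, the ratio is at most
    x_i. Otherwise the truncated numerator is the full one, which settles S >= c. If S < c, the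
    ratio is below N and the exponential exceeds 1. *)
Lemma ratio_exprn_le x I (N c s : R) p : (0 < p)%N -> (forall i, 0 < x i) ->
  0 < N -> 0 < c -> 0 <= s ->
  ((\sum_(j <- I) x j ^+ 2) / (\sum_(j <- I) x j)) ^+ p <=
  \sum_(j <- I) x j ^+ p * (N <= x j)%R%:R
  + (\sum_(j <- I) x j ^+ 2 * (x j < N)%R%:R) ^+ p
    * (Num.max (\sum_(j <- I) x j) c)^-1 ^+ p
  + N ^+ p * expR (s * (c - \sum_(j <- I) x j)).
Proof.
move=> p0 x0 N0 c0 s0.
set S := \sum_(j <- I) x j; set S2 := \sum_(j <- I) x j ^+ 2.
set A := \sum_(j <- I) _ * _; set Z := \sum_(j <- I) _ * (x j < N)%R%:R.
have A0 : 0 <= A by apply: sumr_ge0 => j _; rewrite mulr_ge0// exprn_ge0// ltW.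
have Z0 : 0 <= Z by apply: sumr_ge0 => j _; rewrite mulr_ge0// exprn_ge0// ltW.
have Q0 : 0 <= (Num.max S c)^-1 ^+ p.
  by rewrite exprn_ge0// invr_ge0 le_max (ltW c0) orbT.
have E0 : 0 <= N ^+ p * expR (s * (c - S)) by rewrite mulr_ge0 ?expR_ge0// exprn_ge0// ltW.
have ZQ0 : 0 <= Z ^+ p * (Num.max S c)^-1 ^+ p by rewrite mulr_ge0// exprn_ge0.
have [I0|I0] := eqVneq I [::].
  by rewrite /S2 I0 big_nil mul0r expr0n eqn0Ngt p0 /= !addr_ge0.
have [i iI imax] := seq_argmax x I0.
have S0 : 0 < S.
  by rewrite /S (big_rem i)//= ltr_pwDl// sumr_ge0// => j _; exact: ltW.
have Tx : S2 / S <= x i.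
  rewrite ler_pdivrMr// mulr_sumr /S2 big_seq [leRHS]big_seq.
  by apply: ler_sum => j jI; rewrite expr2 ler_wpM2r ?imax// ltW.
have T0 : 0 <= S2 / S.
  by rewrite divr_ge0 ?(ltW S0)//; apply: sumr_ge0 => j _; exact: sqr_ge0.
have [Nx|xN] := leP N (x i).
  apply: (@le_trans _ _ A); last by rewrite -addrA lerDl addr_ge0.
  rewrite /A (big_rem i)//= Nx mulr1.
  apply: (@le_trans _ _ (x i ^+ p)); first by rewrite lerXn2r// nnegrE// ltW.
  by rewrite lerDl sumr_ge0// => j _; rewrite mulr_ge0// exprn_ge0// ltW.
have [cS|] := boolP (c <= S).
  have -> : Z = S2.
    rewrite /Z /S2 big_seq [RHS]big_seq; apply: eq_bigr => j jI.
    by rewrite (le_lt_trans (imax j jI) xN) mulr1.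
  by rewrite exprMn (max_l cS) addrAC lerDr addr_ge0.
rewrite -ltNge => Sc.
apply: (@le_trans _ _ (N ^+ p)).
  by rewrite lerXn2r// ?nnegrE ?(ltW N0)// (le_trans Tx)// ltW.
apply: (@le_trans _ _ (N ^+ p * expR (s * (c - S)))).
  by rewrite ler_peMr ?exprn_ge0 ?(ltW N0)// -expR0 ler_expR mulr_ge0// subr_ge0 ltW.
by rewrite lerDr addr_ge0.
Qed.

End UpperPointwise.

(** * Expectation of the three upper summands *)

Section UpperBound.
Context (d : measure_display) (T : measurableType d) (R : realType).
Variable P : probability T R.
Variables (X : nat -> T -> R) (m v : R).
Hypotheses (iidX : iid P X) (X_gt0 : forall n w, 0 < X n w).
Hypotheses (EX : Ex P (X 0%N) = m%:E) (EX2 : Ex P (fun w => (X 0%N w ^+ 2)%R) = v%:E).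
Hypotheses (m_gt0 : 0 < m) (v_gt0 : 0 < v).

Let mX i : measurable_fun setT (X i). Proof. by have [] := iidX. Qed.

Let X_ge0 i w : 0 <= X i w. Proof. exact: ltW. Qed.

Let mS1 I : measurable_fun setT (fun w => \sum_(j <- I) X j w).
Proof. by apply: measurable_sum => i. Qed.

Let S1_ge0 I w : 0 <= \sum_(j <- I) X j w.
Proof. by apply: sumr_ge0. Qed.

(** A function such as the identity is nonnegative only on the range of X, whereas equality of laws
    is exploited for functions nonnegative everywhere; the absolute value bridges the two. *)
Lemma Ex_nth (f : R -> R) i : measurable_fun setT f -> (forall x, 0 < x -> 0 <= f x) ->
  Ex P (fun w => (f (X i w))%R) = Ex P (fun w => (f (X 0%N w))%R).
Proof.
move=> mf f0.
transitivity (Ex P (fun w => (`|f (X i w)|)%R)).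
  by apply: eq_Ex => w; rewrite ger0_norm// f0.
rewrite (expectation_same_law iidX (f := fun x => `|f x|))//; last exact: measurableT_comp.
by apply: eq_Ex => w; rewrite ger0_norm// f0.
Qed.

Lemma Ex_sum_first I : Ex P (fun w => (\sum_(j <- I) X j w)%R) = ((size I)%:R * m)%:E.
Proof.
rewrite Ex_sum//.
have Em i : Ex P (X i) = m%:E.
  by rewrite -EX; apply: (@Ex_nth id i) => // x; exact: ltW.
under eq_bigr => i _ do rewrite Em.
rewrite sumEFin big_const_seq count_predT iter_addr addr0.
by rewrite mulr_natl.
Qed.

Lemma Ex_sum_second I : uniq I -> Ex P (fun w => ((\sum_(j <- I) X j w) ^+ 2)%R) =
  ((size I)%:R * v + ((size I)%:R ^+ 2 - (size I)%:R) * m ^+ 2)%:E.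
Proof.
elim: I => [_|i I IH uiI].
  rewrite (@eq_Ex _ _ _ P _ (fun=> 0)) ?Ex_cst.
    by rewrite /= expr0n /= !mul0r subrr mul0r addr0.
  by move=> w; rewrite big_nil expr0n.
have uI : uniq I by move: uiI => /andP[].
pose S w := \sum_(j <- I) X j w.
have mS : measurable_fun setT S by exact: mS1.
have cross : Ex P (fun w => (X i w * S w)%R) = (m * ((size I)%:R * m))%:E.
  have mg : measurable_fun setT (fun u : R * R => `|u.1|).
    by apply: measurableT_comp => //; exact: measurable_fst.
  have := expectation_leave_one_out (z := fun x => x) (f := fun x : R => `|x|)
    (g := fun u : R * R => `|u.1|) iidX (@measurable_id _ _ _) uiI.
  move=> /(_ _ mg); rewrite (_ : Ex P (fun w => (`|X i w| * `|(sums X (fun x => x) I w).1|)%R)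
      = Ex P (fun w => (X i w * S w)%R)); last first.
    by apply: eq_Ex => w; rewrite !ger0_norm//; exact: S1_ge0.
  move=> ->//.
  rewrite (_ : Ex P (fun w => (`|X 0%N w|)%R) = Ex P (X 0%N)); last first.
    by apply: eq_Ex => w; rewrite ger0_norm.
  rewrite (_ : Ex P (fun w => (`|(sums X (fun x => x) I w).1|)%R) = Ex P S); last first.
    by apply: eq_Ex => w; rewrite ger0_norm//; exact: S1_ge0.
  by rewrite EX Ex_sum_first.
have S0 w : 0 <= S w by exact: S1_ge0.
have mXS : measurable_fun setT (fun w => X i w * S w) by exact: measurable_funM.
have XS0 w : 0 <= X i w * S w by exact: mulr_ge0.
transitivity (Ex P (fun w => (X i w ^+ 2 + (2 * (X i w * S w) + S w ^+ 2))%R)).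
  by apply: eq_Ex => w; rewrite big_cons -/(S w); ring.
have m2XS : measurable_fun setT (fun w => 2 * (X i w * S w)).
  exact: measurable_funM.
rewrite ExD; first last.
- by move=> w; rewrite addr_ge0 ?sqr_ge0// mulr_ge0.
- by move=> w; exact: sqr_ge0.
- by apply: measurable_funD => //; exact: measurable_funX.
- exact: measurable_funX.
rewrite ExD//; first last.
- by move=> w; exact: sqr_ge0.
- by move=> w; rewrite mulr_ge0.
- exact: measurable_funX.
rewrite ExZ// cross IH// (Ex_nth (f := fun x => x ^+ 2)); last 2 first.
- exact: exprn_measurable.
- by move=> x _; exact: sqr_ge0.
rewrite EX2 -EFinM -!EFinD; congr (_%:E).
by rewrite /= -natr1; ring.
Qed.

(** Dividing the sum by n m gives [u], with cut 1/2 and mean (size I) / n, so the quadratic bound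
    around 1 applies. The same p is the exponent and the number of indices that the recursion may
    have removed. *)
Lemma Ex_inv_max_sum p : exists2 K : R, 0 <= K & forall n I, (0 < n)%N -> uniq I ->
  (n <= size I + p)%N -> (size I <= n)%N ->
  (Ex P (fun w => ((Num.max (\sum_(j <- I) X j w) (n%:R * m / 2))^-1 ^+ p)%R)
    <= ((n%:R * m)^-1 ^+ p * (1 + K / n%:R))%:E)%E.
Proof.
have [K0 K00 HK] := inv_max_exprn_quadratic R p.
(* With k = size I >= n - p, the three parts absorb the bias p (n - k) / n, the squared bias, and
   the variance of [u] without its negative part. *)
exists (p%:R ^+ 2 + K0 * p%:R ^+ 2 + K0 * v / m ^+ 2).
  by rewrite !addr_ge0// ?mulr_ge0 ?sqr_ge0 ?invr_ge0 ?sqr_ge0// ltW.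
move=> n I n0 uI nI In.
have n0' : 0 < n%:R :> R by rewrite ltr0n.
pose q := n%:R * m; have q0 : 0 < q by rewrite mulr_gt0.
pose u w := q^-1 * \sum_(j <- I) X j w.
have u0 w : 0 <= u w by rewrite mulr_ge0// invr_ge0 ltW.
have mu : measurable_fun setT u by apply: measurable_funM.
pose h (x : R) := (Num.max x 2^-1)^-1 ^+ p.
have h0 x : 0 <= h x by rewrite exprn_ge0// invr_ge0 le_max invr_ge0 ler0n orbT.
have mh : measurable_fun setT h.
  apply: measurable_funX; apply: nonincreasing_measurable => // x y xy.
  rewrite lef_pV2 ?posrE ?lt_max ?invr_gt0 ?ltr0n ?orbT//.
  by rewrite ge_max !le_max xy lexx orbT.
have mhu : measurable_fun setT (fun w => h (u w)) by exact: measurableT_comp.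
have -> : Ex P (fun w => ((Num.max (\sum_(j <- I) X j w) (n%:R * m / 2))^-1 ^+ p)%R)
    = ((q^-1 ^+ p)%:E * Ex P (fun w => (h (u w))%R))%E.
  rewrite -ExZ ?exprn_ge0 ?invr_ge0 ?(ltW q0)//; apply: eq_Ex => w.
  rewrite /h -exprMn -invfM maxr_pMr ?(ltW q0)// /u mulVKf ?gt_eqF//.
rewrite -/q EFinM; apply: lee_wpmul2l.
  by rewrite lee_fin exprn_ge0// invr_ge0 ltW.
pose k := (size I)%:R : R.
have Eu : Ex P u = (q^-1 * (k * m))%:E by rewrite ExZ ?Ex_sum_first ?invr_ge0 ?(ltW q0).
have Eu2 : Ex P (fun w => (u w ^+ 2)%R) = (q^-1 ^+ 2 * (k * v + (k ^+ 2 - k) * m ^+ 2))%:E.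
  rewrite (@eq_Ex _ _ _ P _ (fun w => q^-1 ^+ 2 * (\sum_(j <- I) X j w) ^+ 2)).
    rewrite ExZ ?sqr_ge0// ?Ex_sum_second//; first exact: measurable_funX.
    by move=> w; exact: sqr_ge0.
  by move=> w; rewrite exprMn.
have mu2 : measurable_fun setT (fun w => u w ^+ 2) by exact: measurable_funX.
have pK0 : 0 <= p%:R + 2 * K0 by rewrite addr_ge0// mulr_ge0.
(* The square K0 (u - 1)^2 is expanded and its term -2 K0 u moved to the left, so that both
   integrands are nonnegative. *)
have main : (Ex P (fun w => (h (u w) + (p%:R + 2 * K0) * u w)%R)
    <= Ex P (fun w => ((1 + p%:R + K0) + K0 * u w ^+ 2)%R))%E.
  apply: Ex_le.
  - by apply: measurable_funD => //; exact: measurable_funM.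
  - by apply: measurable_funD => //; exact: measurable_funM.
  - by move=> w; rewrite addr_ge0// mulr_ge0.
  - by move=> w; have := HK _ (u0 w); rewrite -/(h _) !expr2; lra.
move: main; rewrite ExD//; first last.
- by move=> w; rewrite mulr_ge0.
- exact: measurable_funM.
rewrite ExD//; first last.
- by move=> w; rewrite mulr_ge0// sqr_ge0.
- by move=> w; rewrite !addr_ge0.
- exact: measurable_funM.
rewrite Ex_cst (@ExZ _ _ _ P u)// Eu (@ExZ _ _ _ P (fun w => u w ^+ 2))//; last first.
  by move=> w; exact: sqr_ge0.
rewrite Eu2 -!EFinM -EFinD -leeBrDr// -EFinB => main.
apply: (le_trans main); rewrite lee_fin.
have kn : k <= n%:R by rewrite ler_nat.
have nk : n%:R <= k + p%:R by rewrite -natrD ler_nat.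
have n1 : 1 <= n%:R :> R by rewrite (ler_nat _ 1).
have k0 : 0 <= k by [].
clearbody k; clear -kn nk n1 k0 n0' m_gt0 v_gt0 K00 q.
have p0 : 0 <= p%:R :> R by [].
move: (n%:R : R) (p%:R : R) @q kn nk n1 n0' p0 => N r q kn nk n1 n0 r0.
have N0 : N != 0 by rewrite gt_eqF.
have m0 : m != 0 by rewrite gt_eqF.
have -> : 1 + r + K0 + K0 * (q^-1 ^+ 2 * (k * v + (k ^+ 2 - k) * m ^+ 2))
    - (r + 2 * K0) * (q^-1 * (k * m)) =
    1 + r * ((N - k) / N) + K0 * ((N - k) / N) ^+ 2 + K0 * (k / N * (v / m ^+ 2) / N)
     - K0 * (k / N ^+ 2).
  by rewrite /q; field; rewrite N0 m0.
have -> : 1 + (r ^+ 2 + K0 * r ^+ 2 + K0 * v / m ^+ 2) / N =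
    1 + r * (r / N) + K0 * (r ^+ 2 / N) + K0 * (1 * (v / m ^+ 2) / N).
  by field; rewrite N0 m0.
have N'0 : 0 <= N^-1 by rewrite invr_ge0 ltW.
have a1 : (N - k) / N <= r / N by rewrite ler_wpM2r// lerBlDl.
have a0 : 0 <= (N - k) / N by rewrite mulr_ge0// subr_ge0.
have a2 : ((N - k) / N) ^+ 2 <= r ^+ 2 / N.
  apply: (@le_trans _ _ ((r / N) ^+ 2)).
    by rewrite lerXn2r// nnegrE// mulr_ge0.
  rewrite exprMn ler_wpM2l ?sqr_ge0// expr2 ler_piMl// invf_le1//.
have vm : 0 <= v / m ^+ 2 by rewrite mulr_ge0 ?invr_ge0 ?sqr_ge0// ltW.
have a3 : k / N * (v / m ^+ 2) / N <= 1 * (v / m ^+ 2) / N.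
  by rewrite ler_wpM2r// ler_wpM2r// ler_pdivrMr// mul1r.
have a4 : 0 <= K0 * (k / N ^+ 2) by rewrite mulr_ge0// mulr_ge0// invr_ge0 sqr_ge0.
have := ler_wpM2l r0 a1; have := ler_wpM2l K00 a2; have := ler_wpM2l K00 a3.
lra.
Qed.

(** By independence the exponential factors index by index, and each factor is at most 1 - s m + s^2
    v, hence at most the exponential of s^2 v - s m. *)
Lemma Ex_expR_sum (s : R) I : 0 <= s -> uniq I ->
  (Ex P (fun w => (expR (- (s * \sum_(j <- I) X j w)))%R)
     <= (expR ((s ^+ 2 * v - s * m) * (size I)%:R))%:E)%E.
Proof.
move=> s0.
pose f (x : R) := expR (- (s * x)).
have mf : measurable_fun setT f.
  apply: measurableT_comp; first exact: measurable_expR.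
  by apply: measurableT_comp => //; exact: measurable_funM.
have f0 x : 0 <= f x by exact: expR_ge0.
have mfX i : measurable_fun setT (fun w => f (X i w)) by exact: measurableT_comp.
have one : (Ex P (fun w => (f (X 0%N w))%R) <= (expR (s ^+ 2 * v - s * m))%:E)%E.
  have main : (Ex P (fun w => (f (X 0%N w) + s * X 0%N w)%R)
      <= Ex P (fun w => (1 + s ^+ 2 * X 0%N w ^+ 2)%R))%E.
    apply: Ex_le.
    - by apply: measurable_funD => //; exact: measurable_funM.
    - by apply: measurable_funD => //; apply: measurable_funM => //; exact: measurable_funX.
    - by move=> w; rewrite addr_ge0// mulr_ge0.
    - move=> w; have := expRN_quadratic (mulr_ge0 s0 (X_ge0 0%N w)).
      by rewrite -/(f _) exprMn; lra.
  move: main; rewrite ExD//; first last.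
  - by move=> w; rewrite mulr_ge0.
  - exact: measurable_funM.
  rewrite ExD//; first last.
  - by move=> w; rewrite mulr_ge0// sqr_ge0.
  - by apply: measurable_funM => //; exact: measurable_funX.
  rewrite Ex_cst !ExZ ?sqr_ge0//; last 2 first.
  - exact: measurable_funX.
  - by move=> w; exact: sqr_ge0.
  rewrite EX EX2 -!EFinM -EFinD -leeBrDr// -EFinB => /le_trans; apply.
  rewrite lee_fin; have := expR_ge1Dx (s ^+ 2 * v - s * m); lra.
elim: I => [_|i I IH uiI].
  rewrite (@eq_Ex _ _ _ P _ (fun=> 1)) ?Ex_cst ?mulr0 ?expR0//.
  by move=> w; rewrite big_nil mulr0 oppr0 expR0.
have uI : uniq I by move: uiI => /andP[].
have mg : measurable_fun setT (fun u : R * R => f u.1).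
  by apply: measurableT_comp => //; exact: measurable_fst.
have := expectation_leave_one_out (z := fun x => x) (f := f)
    (g := fun u : R * R => f u.1) iidX (@measurable_id _ _ _) uiI mf mg f0 (fun u => f0 u.1).
move=> H; rewrite (@eq_Ex _ _ _ P _ (fun w => f (X i w) * f (sums X (fun x => x) I w).1)); last first.
  by move=> w; rewrite /f -expRD /= big_cons mulrDr opprD.
rewrite H /= -natr1 mulrDr mulr1 addrC expRD EFinM.
apply: lee_pmul => //; [exact: Ex_ge0|exact: Ex_ge0|exact: IH].
Qed.

(** Index lists replace bounded sums because the recursion removes single indices. *)
Lemma ETpE p n : ETp P X p n =
  Ex P (fun w => (((\sum_(j <- iota 0 n) X j w ^+ 2) / (\sum_(j <- iota 0 n) X j w)) ^+ p)%R).
Proof.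
apply: eq_integral => w _; rewrite /Tstat.
by rewrite -[n in iota 0 n]subn0 -!/(index_iota 0 n) !big_mkord.
Qed.

Lemma measurable_ratio_exprn p I : measurable_fun setT
  (fun w => ((\sum_(j <- I) X j w ^+ 2) / (\sum_(j <- I) X j w)) ^+ p).
Proof.
apply: measurable_funX; apply: measurable_funM.
  by apply: measurable_sum => i; exact: measurable_funX.
(* On nonnegative reals the inverse is the real power -1, whose measurability is at hand. *)
have -> : (fun w => (\sum_(j <- I) X j w)^-1) = (fun w => (\sum_(j <- I) X j w) `^ (-1)).
  by apply/funext => w; rewrite powR_inv1.
exact: (measurableT_comp (@measurable_powR R (-1)) (mS1 I)).
Qed.

(** The tail of X enters only through the jump term and through [e], which bounds the higher moments
    of the truncated squares relative to n^k. The remaining error 1/n comes from the denominator and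
    from the Chernoff term. *)
Lemma ETp_upper p : (0 < p)%N -> exists2 C : R, 0 <= C & forall n (e : R),
  (0 < n)%N -> 0 <= e <= 1 ->
  (forall k, (0 < k < p)%N ->
    (Ex P (fun w => ((X 0%N w ^+ 2 * (X 0%N w < n%:R)%R%:R) ^+ k.+1)%R) <= (e * n%:R ^+ k)%:E)%E) ->
  (ETp P X p n <= n%:R%:E * Ex P (fun w => (X 0%N w ^+ p * (n%:R <= X 0%N w)%R%:R)%R)
     + ((v / m) ^+ p + C * (e + n%:R^-1))%:E)%E.
Proof.
move=> p0.
have [C1 C10 HC1] := @moment_recursion _ _ _ _ _ iidX X_gt0 v p p (ltW v_gt0) (leqnn p).
have [K K0 HK] := Ex_inv_max_sum p.
have c0 : 0 < m ^+ 2 / (16 * v) by rewrite divr_gt0 ?exprn_gt0// mulr_gt0.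
have [C3 C30 HC3] := @exprn_expR_decay R _ p c0.
have mp0 : 0 <= m^-1 ^+ p by rewrite exprn_ge0// invr_ge0 ltW.
have vp0 : 0 <= v ^+ p by rewrite exprn_ge0// ltW.
exists (C1 * m^-1 ^+ p * (1 + K) + v ^+ p * m^-1 ^+ p * K + C3).
  by rewrite !addr_ge0// !mulr_ge0// addr_ge0.
move=> n e n0 /andP[e0 e1] He.
have n0' : 0 < n%:R :> R by rewrite ltr0n.
have n1 : n%:R^-1 <= 1 :> R by rewrite invf_le1// (ler_nat _ 1).
have ni0 : 0 <= n%:R^-1 :> R by rewrite invr_ge0 ltW.
pose z (x : R) := x ^+ 2 * (x < n%:R)%R%:R.
have mz : measurable_fun setT z.
  apply: measurable_funM; first exact: exprn_measurable.
  by apply: measurable_fun_bool_natmul; exact: measurable_fun_ltr.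
have z0 x : 0 <= z x by rewrite mulr_ge0// sqr_ge0.
pose c := n%:R * m / 2.
have cc0 : 0 < c by rewrite divr_gt0// mulr_gt0.
pose g (s : R) := (Num.max s c)^-1 ^+ p.
have max0 s : 0 < Num.max s c by rewrite lt_max cc0 orbT.
have g0 s : 0 <= g s by rewrite exprn_ge0// invr_ge0 ltW.
have gmon : {homo g : x y /~ x <= y}.
  move=> x y yx; rewrite /g lerXn2r ?nnegrE ?invr_ge0 ?(ltW (max0 _))//.
  rewrite lef_pV2 ?posrE// ge_max !le_max yx lexx orbT//.
have mg : measurable_fun setT g.
  by apply: nonincreasing_measurable => // x y xy; exact: gmon.
pose I := iota 0 n.
have uI : uniq I by exact: iota_uniq.
have sI : size I = n by exact: size_iota.
(* This minimises the exponent s^2 v - s m / 2 per index that results from the level c = n m / 2;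
   the minimum is - m^2 / (16 v). *)
pose s := m / (4 * v).
have s0 : 0 <= s by rewrite divr_ge0 ?(ltW m_gt0)// mulr_ge0// ltW.
pose f (x : R) := x ^+ p * (n%:R <= x)%R%:R.
have mf : measurable_fun setT f.
  apply: measurable_funM; first exact: exprn_measurable.
  by apply: measurable_fun_bool_natmul; exact: measurable_fun_ler.
have f0 x : 0 < x -> 0 <= f x by move=> x0; rewrite mulr_ge0// exprn_ge0// ltW.
pose F1 w := \sum_(j <- I) f (X j w).
pose F2 w := (sums X z I w).2 ^+ p * g (\sum_(j <- I) X j w).
pose F3 w := (n%:R ^+ p * expR (s * c)) * expR (- (s * \sum_(j <- I) X j w)).
have mF1 : measurable_fun setT F1.
  by apply: measurable_sum => j; exact: measurableT_comp.
have mF2 : measurable_fun setT F2.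
  apply: measurable_funM; last exact: measurableT_comp.
  apply: measurable_funX; apply: (measurableT_comp measurable_snd).
  exact: (measurable_sums iidX mz).
have mE : measurable_fun setT (fun w => expR (- (s * \sum_(j <- I) X j w))).
  apply: measurableT_comp; first exact: measurable_expR.
  by apply: measurableT_comp => //; exact: measurable_funM.
have mF3 : measurable_fun setT F3 by exact: measurable_funM.
have F10 w : 0 <= F1 w by apply: sumr_ge0 => j _; exact: f0.
have F20 w : 0 <= F2 w by rewrite mulr_ge0// exprn_ge0//; apply: sumr_ge0.
have F30 w : 0 <= F3 w by rewrite !mulr_ge0 ?expR_ge0 ?exprn_ge0.
have step : (ETp P X p n <= Ex P (fun w => (F1 w + F2 w + F3 w)%R))%E.
  rewrite ETpE; apply: Ex_le.
  - exact: measurable_ratio_exprn.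
  - by apply: measurable_funD => //; exact: measurable_funD.
  - move=> w; rewrite exprn_ge0// divr_ge0//.
    by apply: sumr_ge0 => j _; exact: sqr_ge0.
  - move=> w; have := @ratio_exprn_le R (X^~ w) I n%:R c s p p0 (X_gt0^~ w) n0' cc0 s0.
    by rewrite /F1 /F2 /F3 -mulrA -expRD mulrBr.
apply: (le_trans step).
have mF12 : measurable_fun setT (fun w => F1 w + F2 w) by exact: measurable_funD.
rewrite ExD//; last by move=> w; exact: addr_ge0.
rewrite ExD// -addeA; apply: leeD.
  rewrite Ex_sum//; last 2 first.
  - by move=> j; exact: measurableT_comp.
  - by move=> j w; exact: f0.
  under eq_bigr => j _ do rewrite (Ex_nth _ mf f0).
  by rewrite big_const_seq count_predT sI iter_addr adde0 mule_natl.
have E2 : (Ex P F2 <= (n%:R ^+ p * (v ^+ p + C1 * e) * ((n%:R * m)^-1 ^+ p * (1 + K / n%:R)))%:E)%E.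
  apply: (HC1 n e _ z g) => //.
  - by rewrite e0.
  - by rewrite mulr_ge0// ?addr_ge0 ?mulr_ge0// exprn_ge0// invr_ge0 mulr_ge0// ltW.
  - rewrite -EX2; apply: Ex_le.
    + exact: measurableT_comp.
    + exact: measurable_funX.
    + by move=> w.
    + by move=> w; rewrite /z ler_piMr ?sqr_ge0// lern1 leq_b1.
  - by move=> J uJ nJ Jn; exact: HK.
  - by rewrite sI.
  - by rewrite sI.
have E3 : (Ex P F3 <= (C3 / n%:R)%:E)%E.
  rewrite ExZ ?mulr_ge0 ?expR_ge0 ?exprn_ge0//.
  apply: (@le_trans _ _ ((n%:R ^+ p * expR (s * c))%:E * (expR ((s ^+ 2 * v - s * m) * n%:R))%:E)%E).
    apply: lee_wpmul2l; first by rewrite lee_fin mulr_ge0 ?expR_ge0 ?exprn_ge0.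
    by have := Ex_expR_sum s0 uI; rewrite sI.
  rewrite -EFinM lee_fin -mulrA -expRD.
  have -> : s * c + (s ^+ 2 * v - s * m) * n%:R = - (m ^+ 2 / (16 * v) * n%:R).
    by rewrite /s /c; field; rewrite gt_eqF.
  exact: HC3.
apply: (le_trans (leeD E2 E3)); rewrite -EFinD lee_fin.
have -> : n%:R ^+ p * (v ^+ p + C1 * e) * ((n%:R * m)^-1 ^+ p * (1 + K / n%:R)) =
   (v ^+ p + C1 * e) * (m^-1 ^+ p * (1 + K / n%:R)).
  have nn : n%:R ^+ p * n%:R^-1 ^+ p = 1 :> R by rewrite -exprMn divff ?expr1n// gt_eqF.
  rewrite invfM exprMn.
  transitivity ((n%:R ^+ p * n%:R^-1 ^+ p) * ((v ^+ p + C1 * e) * (m^-1 ^+ p * (1 + K / n%:R)))).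
    by move: (n%:R ^+ p : R) (n%:R^-1 ^+ p : R) (m^-1 ^+ p) (v ^+ p) (K / n%:R) => *; ring.
  by rewrite nn mul1r.
rewrite exprMn.
have a1 : C1 * e * m^-1 ^+ p * (K * n%:R^-1) <= C1 * e * m^-1 ^+ p * K.
  by rewrite ler_wpM2l ?mulr_ge0// ler_piMr.
have a2 : 0 <= (C1 * m^-1 ^+ p * (1 + K)) * n%:R^-1 by rewrite !mulr_ge0// addr_ge0.
have a3 : 0 <= (v ^+ p * m^-1 ^+ p * K + C3) * e by rewrite mulr_ge0// addr_ge0// !mulr_ge0.
move: a1 a2 a3; move: (m^-1 ^+ p) (v ^+ p) (n%:R^-1 : R) => x y t; nra.
Qed.

End UpperBound.

(** * Lower bound *)

Section LowerPointwise.
Context (R : realType).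
Implicit Types (x : nat -> R) (I : seq nat).

(** The denominator is at most x_i + L N <= (1 + L) x_i and the numerator at least x_i^2. *)
Lemma ratio_ge_isolated x I (N L : R) i : (forall j, 0 < x j) -> 0 < N -> 0 < L ->
  i \in I -> N <= x i -> \sum_(j <- rem i I) x j <= L * N ->
  N / (1 + L) <= (\sum_(j <- I) x j ^+ 2) / (\sum_(j <- I) x j).
Proof.
move=> x0 N0 L0 iI Nx rest.
have r0 : 0 <= \sum_(j <- rem i I) x j by apply: sumr_ge0 => j _; exact: ltW.
have r20 : 0 <= \sum_(j <- rem i I) x j ^+ 2 by apply: sumr_ge0 => j _; exact: sqr_ge0.
have bigE (f : nat -> R) : \sum_(j <- I) f j = f i + \sum_(j <- rem i I) f j.
  exact: big_rem.
rewrite !bigE.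
have L1 : 0 < 1 + L by rewrite addr_gt0.
have S0 : 0 < x i + \sum_(j <- rem i I) x j by rewrite ltr_pwDl.
rewrite ler_pdivlMr// mulrAC ler_pdivrMr//.
have xi0 := x0 i.
move: (x i) (\sum_(j <- rem i I) x j) (\sum_(j <- rem i I) x j ^+ 2) xi0 Nx rest r0 r20
  => X r r2 X0 NX rLN r0 r20 {S0}.
have a1 : N * r <= X * (L * X).
  apply: (@le_trans _ _ (X * (L * N))).
    by apply: ler_pM => //; exact: ltW.
  by rewrite ler_wpM2l ?(ltW X0)// ler_wpM2l ?(ltW L0).
have a2 : N * X <= X * X by rewrite ler_wpM2r// ltW.
have a3 : 0 <= r2 * (1 + L) by rewrite mulr_ge0// ltW.
rewrite mulrDr mulrDl expr2; nra.
Qed.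

(* The sum of the [(N <= x i)] minus the double sum on the right is at most 1, and
   positive only if exactly one [x i] is at least [N] and the others sum to at
   most [4 m N]; then the ratio is at least [N / (1 + 4 m)]. *)
Lemma ratio_exprn_ge x I (kap : R -> R) (N m mu : R) p :
  (forall j, 0 < x j) -> uniq I -> I != [::] -> N = (size I)%:R ->
  0 < m -> 0 <= mu -> (2 <= p)%N ->
  (forall u, 0 < u -> 0 <= kap u <= u ^+ 2) ->
  2 * p%:R * mu ^+ p.-1 <= (N / (1 + 4 * m)) ^+ p.-1 ->
  2 * p%:R * mu ^+ p.-1 / m * (N^-1 * \sum_(i <- I) kap (x i))
  + 2^-1 * (N / (1 + 4 * m)) ^+ p * \sum_(i <- I) (N <= x i)%R%:R
  <= ((\sum_(j <- I) x j ^+ 2) / (\sum_(j <- I) x j)) ^+ p + p.-1%:R * mu ^+ p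
  + p%:R * mu ^+ p.-1 / m ^+ 2 * (N^-1 ^+ 2 * \sum_(i <- I) \sum_(j <- I) kap (x i) * x j)
  + 2^-1 * (N / (1 + 4 * m)) ^+ p *
     \sum_(i <- I) \sum_(j <- rem i I)
       ((4 * m * N)^-1 * ((N <= x i)%R%:R * x j) + (N <= x i)%R%:R * (N <= x j)%R%:R).
Proof.
case: p => [//|[//|q]] x0 uI I0 NE m0 mu0 _ kap2 hN; rewrite /= in hN *.
set p := q.+2 in hN *.
have N0 : 0 < N by rewrite NE ltr0n lt0n size_eq0.
set tau := N / (1 + 4 * m) in hN *.
have m1 : 0 < 1 + 4 * m by rewrite addr_gt0// mulr_gt0.
have tau0 : 0 < tau by rewrite divr_gt0.
set A := \sum_(i <- I) kap (x i).
set S := \sum_(j <- I) x j.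
set S2 := \sum_(j <- I) x j ^+ 2.
set t := S2 / S.
have S0 : 0 < S.
  have [i iI _] := seq_argmax x I0.
  by rewrite /S (big_rem i)//= ltr_pwDl// sumr_ge0// => j _; exact: ltW.
have A0 : 0 <= A by apply: sumr_ge0 => i _; have /andP[] := kap2 _ (x0 i).
have AS2 : A <= S2 by apply: ler_sum => i _; have /andP[] := kap2 _ (x0 i).
have S20 : 0 <= S2 by apply: le_trans AS2.
have t0 : 0 <= t by rewrite divr_ge0// ltW.
have -> : \sum_(i <- I) \sum_(j <- I) kap (x i) * x j = A * S.
  by rewrite mulr_suml; apply: eq_bigr => i _; rewrite mulr_sumr.
(* [1/b >= 2/m - b/m^2], the tangent of [1/b] at [m] *)
have lin : 2 / m * (N^-1 * A) <= t + m^-1 ^+ 2 * (N^-1 ^+ 2 * (A * S)).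
  apply: (@le_trans _ _ (A / S + m^-1 ^+ 2 * (N^-1 ^+ 2 * (A * S)))); last first.
    by rewrite lerD2r ler_wpM2r// invr_ge0 ltW.
  have -> : A / S + m^-1 ^+ 2 * (N^-1 ^+ 2 * (A * S)) = 2 / m * (N^-1 * A)
      + A / S * (1 - S / (m * N)) ^+ 2.
    by field; rewrite !gt_eqF.
  by rewrite lerDl mulr_ge0 ?sqr_ge0// divr_ge0// ltW.
pose rest i := \sum_(j <- rem i I)
       ((4 * m * N)^-1 * ((N <= x i)%R%:R * x j) + (N <= x i)%R%:R * (N <= x j)%R%:R).
rewrite -/(rest _).
pose D := \sum_(i <- I) ((N <= x i)%R%:R - rest i).
have DE : D = \sum_(i <- I) (N <= x i)%R%:R - \sum_(i <- I) rest i by rewrite /D sumrB.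
have mN0 : 0 < 4 * m * N by rewrite !mulr_gt0.
have rest_ge0 i : 0 <= rest i.
  apply: sumr_ge0 => j _; rewrite addr_ge0// mulr_ge0// ?mulr_ge0 ?invr_ge0// ltW//.
have tangent : p%:R * mu ^+ q.+1 * t <= t ^+ p + q.+1%:R * mu ^+ p.
  exact: exprn_tangent.
have pm0 : 0 <= p%:R * mu ^+ q.+1 by rewrite mulr_ge0// exprn_ge0.
(* If D <= 0 the tangent alone suffices. If D > 0 there is an isolated jump, so t >= tau; then [hN]
   bounds the tangent term by t^p / 2, and D <= 1 bounds the jump term by t^p / 2. *)
have key : p%:R * mu ^+ q.+1 * t + 2^-1 * tau ^+ p * D <= t ^+ p + q.+1%:R * mu ^+ p.
  have [D0|D0] := leP D 0.
    apply: le_trans tangent; rewrite gerDl mulr_ge0_le0//.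
    by rewrite mulr_ge0// exprn_ge0// ltW.
  have [i iI iD] : exists2 i, i \in I & 0 < (N <= x i)%R%:R - rest i.
    apply: contrapT => H; move: D0; rewrite ltNge /D big_seq sumr_le0// => i iI.
    by rewrite leNgt; apply/negP => ?; apply: H; exists i.
  have Nxi : N <= x i.
    by move: iD; case: (N <= x i) => //; rewrite sub0r oppr_gt0 ltNge rest_ge0.
  have rest1 : rest i < 1 by move: iD; rewrite Nxi subr_gt0.
  have restE : rest i = (4 * m * N)^-1 * \sum_(j <- rem i I) x j
      + \sum_(j <- rem i I) (N <= x j)%R%:R.
    rewrite /rest big_split /= Nxi mulr_sumr; congr (_ + _); apply: eq_bigr => j _;
    by rewrite mul1r.
  have rx0 : 0 <= (4 * m * N)^-1 * \sum_(j <- rem i I) x j.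
    by rewrite mulr_ge0 ?invr_ge0 ?(ltW mN0)// sumr_ge0// => j _; exact: ltW.
  have rN0 : 0 <= \sum_(j <- rem i I) (N <= x j)%R%:R :> R by exact: sumr_ge0.
  have small j : j \in rem i I -> (N <= x j) = false.
    move=> jI; apply/negbTE/negP => Nxj; move: rest1; rewrite restE ltNge => /negP; apply.
    apply: (@le_trans _ _ (\sum_(j <- rem i I) (N <= x j)%R%:R)); last by rewrite lerDr.
    by rewrite (big_rem j)//= Nxj lerDl sumr_ge0.
  have rest4 : \sum_(j <- rem i I) x j <= 4 * m * N.
    have : (4 * m * N)^-1 * \sum_(j <- rem i I) x j < 1.
      by apply: le_lt_trans rest1; rewrite restE lerDl.
    by rewrite mulrC ltr_pdivrMr// mul1r => /ltW.
  have tau_t : tau <= t by apply: (ratio_ge_isolated x0 N0 _ iI Nxi rest4); rewrite mulr_gt0.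
  have D1 : D <= 1.
    rewrite /D (big_rem i)//= big_seq.
    rewrite Nxi -[leRHS]addr0 lerD//; first by rewrite gerBl.
    by apply: sumr_le0 => j /small ->; rewrite sub0r oppr_le0.
  have b1 : 2^-1 * tau ^+ p * D <= 2^-1 * t ^+ p.
    apply: (@le_trans _ _ (2^-1 * tau ^+ p)).
      by rewrite ler_piMr// mulr_ge0// exprn_ge0// ltW.
    by rewrite ler_wpM2l// lerXn2r// nnegrE// ltW.
  have b2 : p%:R * mu ^+ q.+1 * t <= 2^-1 * t ^+ p.
    have : 2 * p%:R * mu ^+ q.+1 <= t ^+ q.+1.
      by apply: le_trans hN _; rewrite lerXn2r// nnegrE// ltW.
    move=> /(ler_wpM2r t0); rewrite -exprSr -/p; lra.
  have b3 : 0 <= q.+1%:R * mu ^+ p by rewrite mulr_ge0// exprn_ge0.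
  lra.
move: key; rewrite DE => key.
have := ler_wpM2l pm0 lin.
rewrite -exprVn in key *.
move: key; move: (\sum_(i <- I) (N <= x i)%R%:R) (\sum_(i <- I) rest i) => s r.
rewrite mulrBr; move: (2^-1 * tau ^+ p * s) (2^-1 * tau ^+ p * r) => sr rr.
rewrite mulrDr.
have -> : p%:R * mu ^+ q.+1 * (2 / m * (N^-1 * A)) = 2 * p%:R * mu ^+ q.+1 / m * (N^-1 * A) by ring.
rewrite [p%:R * mu ^+ q.+1 * (m^-1 ^+ 2 * _)]mulrA.
lra.
Qed.

End LowerPointwise.

(** * Expectation of the lower bound *)

Section LowerBound.
Context (d : measure_display) (T : measurableType d) (R : realType).
Variable P : probability T R.
Variables (X : nat -> T -> R) (m : R).
Hypotheses (iidX : iid P X) (X_gt0 : forall n w, 0 < X n w).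
Hypotheses (EX : Ex P (X 0%N) = m%:E) (m_gt0 : 0 < m).

Let mX i : measurable_fun setT (X i). Proof. by have [] := iidX. Qed.

Let X_ge0 i w : 0 <= X i w. Proof. exact: ltW. Qed.

(** Independent pairs put at most kb into the cross term, against 2 kb from the tangent, and the n
    diagonal pairs give D / n. The double sum removes at most half of the expected number n t of
    jumps: a quarter because the other points have mean sum (n - 1) m against 4 m n, and a quarter
    through a second jump, as n t <= 1/4. *)
Lemma ETp_lower (kap : R -> R) (kb D mu t : R) p n : (2 <= p)%N -> (0 < n)%N ->
  measurable_fun setT kap -> (forall u, 0 <= kap u <= u ^+ 2) -> 0 <= mu ->
  Ex P (fun w => (kap (X 0%N w))%R) = kb%:E ->
  Ex P (fun w => (kap (X 0%N w) * X 0%N w)%R) = D%:E ->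
  Ex P (fun w => ((n%:R <= X 0%N w)%R%:R)%R) = t%:E ->
  2 * p%:R * mu ^+ p.-1 <= (n%:R / (1 + 4 * m)) ^+ p.-1 ->
  n%:R * t <= 4^-1 ->
  ((p%:R * mu ^+ p.-1 / m * kb + 4^-1 * (n%:R / (1 + 4 * m)) ^+ p * (n%:R * t))%:E
   <= ETp P X p n + (p.-1%:R * mu ^+ p + p%:R * mu ^+ p.-1 / m ^+ 2 * (D / n%:R))%:E)%E.
Proof.
move=> p2 n0 mk kap2 mu0 Ekb ED Et hN ht.
have n0' : 0 < n%:R :> R by rewrite ltr0n.
pose I := iota 0 n.
have uI : uniq I by exact: iota_uniq.
have sI : size I = n by exact: size_iota.
have I0 : I != [::] by rewrite -size_eq0 sI -lt0n.
pose one (u : R) : R := (n%:R <= u)%R%:R.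
have mone : measurable_fun setT one.
  by apply: measurable_fun_bool_natmul; exact: measurable_fun_ler.
have k0 u : 0 <= kap u by have /andP[] := kap2 u.
have one0 u : 0 <= one u by [].
have mkX i : measurable_fun setT (fun w => kap (X i w)) by exact: measurableT_comp.
have moX i : measurable_fun setT (fun w => one (X i w)) by exact: measurableT_comp.
have E1 (f : R -> R) i : measurable_fun setT f -> (forall u, 0 <= f u) ->
    Ex P (fun w => (f (X i w))%R) = Ex P (fun w => (f (X 0%N w))%R).
  by move=> mf f0; exact: (expectation_same_law iidX).
have t0 : 0 <= t by rewrite -lee_fin -Et; apply: Ex_ge0.
have kb0 : 0 <= kb by rewrite -lee_fin -Ekb; apply: Ex_ge0.
have D0 : 0 <= D by rewrite -lee_fin -ED; apply: Ex_ge0 => w; rewrite mulr_ge0.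
have mabs : measurable_fun setT (fun u : R => `|u|) by exact: measurableT_comp.
have pairX (f : R -> R) i j : measurable_fun setT f -> (forall u, 0 <= f u) -> i != j ->
    Ex P (fun w => (f (X i w) * X j w)%R) = (Ex P (fun w => (f (X 0%N w))%R) * m%:E)%E.
  move=> mf f0 ij; rewrite -EX.
  rewrite (@eq_Ex _ _ _ P (X 0%N) (fun w => `|X 0%N w|)); last by move=> w; rewrite ger0_norm.
  rewrite -(expectation_pair iidX (f := f) (g := fun u => `|u|) ij)//.
  by apply: eq_Ex => w; rewrite [`|X j w|]ger0_norm.
pose cA := 2 * p%:R * mu ^+ p.-1 / m * n%:R^-1.
pose cB := 2^-1 * (n%:R / (1 + 4 * m)) ^+ p.
pose cC := p%:R * mu ^+ p.-1 / m ^+ 2 * n%:R^-1 ^+ 2.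
pose cD := (4 * m * n%:R)^-1.
have cA0 : 0 <= cA by rewrite !mulr_ge0 ?invr_ge0 ?exprn_ge0// ltW.
have m1 : 0 < 1 + 4 * m by rewrite addr_gt0// mulr_gt0.
have cB0 : 0 <= cB by rewrite mulr_ge0// exprn_ge0// divr_ge0// ltW.
have cC0 : 0 <= cC by rewrite !mulr_ge0 ?invr_ge0 ?exprn_ge0 ?invr_ge0// ltW.
have cD0 : 0 <= cD by rewrite invr_ge0 !mulr_ge0// ltW.
pose F w := ((\sum_(j <- I) X j w ^+ 2) / (\sum_(j <- I) X j w)) ^+ p.
pose G w := \sum_(i <- I) \sum_(j <- I) kap (X i w) * X j w.
pose H w := \sum_(i <- I) \sum_(j <- rem i I)
   (cD * (one (X i w) * X j w) + one (X i w) * one (X j w)).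
have mF : measurable_fun setT F by exact: (measurable_ratio_exprn iidX X_gt0).
have F0 w : 0 <= F w.
  by rewrite exprn_ge0// divr_ge0//; apply: sumr_ge0 => j _; rewrite ?sqr_ge0.
have mkXX i j : measurable_fun setT (fun w => kap (X i w) * X j w) by exact: measurable_funM.
have kXX0 i j w : 0 <= kap (X i w) * X j w by rewrite mulr_ge0.
have mG : measurable_fun setT G.
  by apply: measurable_sum => i; apply: measurable_sum => j.
have G0 w : 0 <= G w by apply: sumr_ge0 => i _; apply: sumr_ge0.
have moX2 i j : measurable_fun setT (fun w => one (X i w) * X j w) by exact: measurable_funM.
have mcX2 i j : measurable_fun setT (fun w => cD * (one (X i w) * X j w)).
  exact: measurable_funM.
have moo i j : measurable_fun setT (fun w => one (X i w) * one (X j w)) by exact: measurable_funM.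
have moH i j : measurable_fun setT (fun w => cD * (one (X i w) * X j w) + one (X i w) * one (X j w)).
  exact: measurable_funD.
have oX0 i j w : 0 <= one (X i w) * X j w by rewrite mulr_ge0.
have coX0 i j w : 0 <= cD * (one (X i w) * X j w) by rewrite mulr_ge0.
have oo0 i j w : 0 <= one (X i w) * one (X j w) by rewrite mulr_ge0.
have ooH0 i j w : 0 <= cD * (one (X i w) * X j w) + one (X i w) * one (X j w) by rewrite addr_ge0.
have mH : measurable_fun setT H.
  by apply: measurable_sum => i; apply: measurable_sum => j.
have H0 w : 0 <= H w by apply: sumr_ge0 => i _; apply: sumr_ge0.
have mskap : measurable_fun setT (fun w => \sum_(i <- I) kap (X i w)) by exact: measurable_sum.
have msone : measurable_fun setT (fun w => \sum_(i <- I) one (X i w)) by exact: measurable_sum.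
have skap0 w : 0 <= \sum_(i <- I) kap (X i w) by exact: sumr_ge0.
have sone0 w : 0 <= \sum_(i <- I) one (X i w) by exact: sumr_ge0.
pose c0 := p.-1%:R * mu ^+ p.
have c00 : 0 <= c0 by rewrite mulr_ge0// exprn_ge0.
have mL1 : measurable_fun setT (fun w => cA * \sum_(i <- I) kap (X i w)) by exact: measurable_funM.
have mL2 : measurable_fun setT (fun w => cB * \sum_(i <- I) one (X i w)) by exact: measurable_funM.
have mR1 : measurable_fun setT (fun w => F w + c0) by exact: measurable_funD.
have mR2 : measurable_fun setT (fun w => cC * G w) by exact: measurable_funM.
have mR3 : measurable_fun setT (fun w => cB * H w) by exact: measurable_funM.
have mR12 : measurable_fun setT (fun w => F w + c0 + cC * G w) by exact: measurable_funD.
have main : (Ex P (fun w => (cA * \sum_(i <- I) kap (X i w) + cB * \sum_(i <- I) one (X i w))%R)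
   <= Ex P (fun w => (F w + c0 + cC * G w + cB * H w)%R))%E.
  apply: Ex_le.
  - exact: measurable_funD.
  - exact: measurable_funD.
  - by move=> w; rewrite addr_ge0// mulr_ge0.
  - move=> w.
    have := @ratio_exprn_ge R (X^~ w) I kap n%:R m mu p (X_gt0^~ w) uI I0.
    rewrite sI => /(_ erefl m_gt0 mu0 p2 (fun u _ => kap2 u) hN).
    by rewrite -/cB -/(F w) -/c0 -/(H w) -/(G w) [_ / m * (_ * _)]mulrA
       [_ / m ^+ 2 * (_ * _)]mulrA.
have L1 : Ex P (fun w => (\sum_(i <- I) kap (X i w))%R) = (n%:R * kb)%:E.
  rewrite Ex_sum//; under eq_bigr => i _ do rewrite (E1 kap)// Ekb.
  by rewrite sumEFin big_const_seq count_predT sI iter_addr addr0 mulr_natl.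
have L2 : Ex P (fun w => (\sum_(i <- I) one (X i w))%R) = (n%:R * t)%:E.
  rewrite Ex_sum//; under eq_bigr => i _ do rewrite (E1 one)// Et.
  by rewrite sumEFin big_const_seq count_predT sI iter_addr addr0 mulr_natl.
have n1 : n.-1%:R = n%:R - 1 :> R by rewrite -subn1 natrB.
have EG : Ex P G = (n%:R * (D + (n%:R - 1) * (kb * m)))%:E.
  rewrite Ex_sum//; last 2 first.
  - by move=> i; apply: measurable_sum => j.
  - by move=> i w; apply: sumr_ge0.
  rewrite big_seq (eq_bigr (fun=> (D + (n%:R - 1) * (kb * m))%:E)) -?big_seq.
    by rewrite sumEFin big_const_seq count_predT sI iter_addr addr0 mulr_natl.
  move=> i iI; rewrite Ex_sum// (big_rem i)//= EFinD; congr (_ + _)%E.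
    rewrite -ED.
    have := E1 (fun u => kap u * `|u|) i.
    have -> : Ex P (fun w => (kap (X i w) * `|X i w|)%R) = Ex P (fun w => (kap (X i w) * X i w)%R).
      by apply: eq_Ex => w; rewrite ger0_norm.
    have -> : Ex P (fun w => (kap (X 0%N w) * `|X 0%N w|)%R) = Ex P (fun w => (kap (X 0%N w) * X 0%N w)%R).
      by apply: eq_Ex => w; rewrite ger0_norm.
    apply; first exact: measurable_funM.
    by move=> u; rewrite mulr_ge0.
  rewrite big_seq (eq_bigr (fun=> (kb * m)%:E)) -?big_seq.
    rewrite sumEFin big_const_seq count_predT size_rem// sI iter_addr addr0.
    by rewrite -n1 mulr_natl.
  move=> j jI; rewrite pairX ?Ekb//.
  by apply/eqP => ij; move: jI; rewrite -ij mem_rem_uniq// !inE eqxx.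
have EH : Ex P H = (n%:R * ((n%:R - 1) * (cD * (t * m) + t * t)))%:E.
  rewrite Ex_sum//; last 2 first.
  - by move=> i; apply: measurable_sum => j.
  - by move=> i w; apply: sumr_ge0.
  rewrite big_seq (eq_bigr (fun=> ((n%:R - 1) * (cD * (t * m) + t * t))%:E)) -?big_seq.
    by rewrite sumEFin big_const_seq count_predT sI iter_addr addr0 mulr_natl.
  move=> i iI; rewrite Ex_sum//.
  rewrite big_seq (eq_bigr (fun=> (cD * (t * m) + t * t)%:E)) -?big_seq.
    rewrite sumEFin big_const_seq count_predT size_rem// sI iter_addr addr0.
    by rewrite -n1 mulr_natl.
  move=> j jI.
  have ij : i != j.
    by apply/eqP => ij; move: jI; rewrite -ij mem_rem_uniq// !inE eqxx.
  rewrite ExD// ExZ// pairX// Et (expectation_pair iidX (f := one) (g := one) ij)// Et.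
  by rewrite -!EFinM -EFinD.
move: main; rewrite ExD//; last 2 first.
- by move=> w; rewrite mulr_ge0.
- by move=> w; rewrite mulr_ge0.
rewrite ExD//; last 2 first.
- by move=> w; rewrite !addr_ge0// mulr_ge0.
- by move=> w; rewrite mulr_ge0.
rewrite ExD//; last 2 first.
- by move=> w; rewrite !addr_ge0.
- by move=> w; rewrite mulr_ge0.
rewrite ExD// Ex_cst.
rewrite (@ExZ _ _ _ P (fun w => \sum_(i <- I) kap (X i w)))//.
rewrite (@ExZ _ _ _ P (fun w => \sum_(i <- I) one (X i w)))//.
rewrite (@ExZ _ _ _ P G)// (@ExZ _ _ _ P H)// L1 L2 EG EH.
have -> : ETp P X p n = Ex P F by rewrite ETpE.
move: (Ex P F) => y.
rewrite -!EFinM -!EFinD -!addeA -!EFinD.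
rewrite -leeBlDr// -EFinB -[in X in _ -> X]leeBlDr// -EFinB.
apply: le_trans; rewrite lee_fin.
have N1 : 1 <= n%:R :> R by rewrite (ler_nat _ 1).
have nt0 : 0 <= n%:R * t by rewrite mulr_ge0.
have h1 : n%:R * ((n%:R - 1) * (cD * (t * m) + t * t)) <= n%:R * t * 2^-1.
  have e1 : n%:R * (cD * (t * m) + t * t) = 4^-1 * t + (n%:R * t) * t.
    by rewrite /cD; field; rewrite !gt_eqF.
  have e2 : n%:R * (cD * (t * m) + t * t) <= t * 2^-1.
    rewrite e1; have := ler_wpM2r t0 ht; lra.
  have e3 : 0 <= cD * (t * m) + t * t by rewrite addr_ge0 ?mulr_ge0// ltW.
  rewrite -mulrA ler_wpM2l//; apply: le_trans e2.
  by rewrite ler_wpM2r// gerBl.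
have h2 := ler_wpM2l cB0 h1.
have h3 : cC * (n%:R * (D + (n%:R - 1) * (kb * m))) <=
   p%:R * mu ^+ p.-1 / m ^+ 2 * (D / n%:R) + p%:R * mu ^+ p.-1 / m * kb.
  have -> : p%:R * mu ^+ p.-1 / m ^+ 2 * (D / n%:R) + p%:R * mu ^+ p.-1 / m * kb =
    cC * (n%:R * (D + (n%:R - 1) * (kb * m))) + cC * n%:R * (kb * m).
    by rewrite /cC; field; rewrite !gt_eqF.
  rewrite lerDl; apply: mulr_ge0; apply: mulr_ge0 => //; exact: ltW.
have h4 : cA * (n%:R * kb) = 2 * (p%:R * mu ^+ p.-1 / m * kb).
  by rewrite /cA; field; rewrite !gt_eqF.
rewrite h4.
have -> : 4^-1 * (n%:R / (1 + 4 * m)) ^+ p * (n%:R * t) =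
   cB * (n%:R * t) - cB * (n%:R * t * 2^-1) by rewrite /cB; field.
rewrite -/c0.
move: h2 h3.
move: (cB * (n%:R * t)) (cB * (n%:R * t * 2^-1)) (cB * _) (cC * _) (_ / m * kb) (_ / m ^+ 2 * _).
move=> a1 a2 a3 a4 a5 a6; lra.
Qed.

End LowerBound.

(** * Dyadic estimates of moments by tails *)

Section Dyadic.
Context (d : measure_display) (T : measurableType d) (R : realType).
Variable P : probability T R.
Variable Y : T -> R.
Hypotheses (mY : measurable_fun setT Y) (Y_gt0 : forall w, 0 < Y w).

Let mle (x : R) : measurable_fun setT (fun w => (x <= Y w)%R%:R : R).
Proof. by apply: measurable_fun_bool_natmul; exact: measurable_fun_ler. Qed.

Let mcc (x y : R) : measurable_fun setT (fun w => (x <= Y w < y)%R%:R : R).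
Proof.
apply: measurable_fun_bool_natmul; apply: measurable_and.
  exact: measurable_fun_ler.
exact: measurable_fun_ltr.
Qed.

Let mpow (a : R) : measurable_fun setT (fun w => Y w `^ a).
Proof. exact: (measurableT_comp (@measurable_powR R a) mY). Qed.

(** On a block [u, 2u) the integrand is at most (2u)^a, and the block has probability at most eta
    u^-s; the levels u = y 2^j form a geometric sequence. *)
Lemma dyadic_moment (a s eta y : R) J : 0 <= a -> 0 <= eta -> 0 < y ->
  (forall x, y <= x -> (Ex P (fun w => ((x <= Y w)%R%:R)%R) <= (eta * x `^ (- s))%:E)%E) ->
  (Ex P (fun w => (Y w `^ a * (y <= Y w < y * 2 ^+ J)%R%:R)%R)
    <= (2 `^ a * eta * y `^ (a - s) * \sum_(j < J) (2 `^ (a - s)) ^+ j)%:E)%E.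
Proof.
move=> a0 eta0 y0 tail.
elim: J => [|J IH].
  rewrite (@eq_Ex _ _ _ P _ (fun=> 0)) ?Ex_cst; first by rewrite big_ord0 mulr0.
  by move=> w; rewrite expr0 mulr1; case: (leP y (Y w)) => _; rewrite /= mulr0.
pose u := y * 2 ^+ J.
have u0 : 0 < u by rewrite mulr_gt0// exprn_gt0.
have yu : y <= u by rewrite ler_peMr ?(ltW y0)// exprn_ege1// ler1n.
have mF x z : measurable_fun setT (fun w => Y w `^ a * (x <= Y w < z)%R%:R).
  exact: measurable_funM.
have mG : measurable_fun setT (fun w => (2 * u) `^ a * (u <= Y w)%R%:R).
  exact: measurable_funM.
have F0 x z w : 0 <= Y w `^ a * (x <= Y w < z)%R%:R by rewrite mulr_ge0// powR_ge0.
have G0 w : 0 <= (2 * u) `^ a * (u <= Y w)%R%:R by rewrite mulr_ge0// powR_ge0.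
apply: (@le_trans _ _ (Ex P (fun w => (Y w `^ a * (y <= Y w < u)%R%:R
    + (2 * u) `^ a * (u <= Y w)%R%:R)%R))).
  apply: Ex_le => // [|w]; first exact: measurable_funD.
  have -> : y * 2 ^+ J.+1 = 2 * u by rewrite exprS /u; ring.
  have [Yu|uY] := ltP (Y w) u.
    rewrite mulr0 addr0 ler_wpM2l ?powR_ge0// ler_nat andbT.
    by case: (y <= Y w) => //=; rewrite leq_b1.
  rewrite andbF mulr0 add0r mulr1.
  case: (ltP (Y w) (2 * u)) => Y2u; last by rewrite andbF mulr0 powR_ge0.
  rewrite andbT (le_trans yu uY) mulr1 ge0_ler_powR// ?nnegrE ltW//.
  by rewrite mulr_gt0.
rewrite ExD// big_ord_recr /= mulrDr EFinD; apply: leeD => //.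
rewrite ExZ ?powR_ge0//.
apply: (@le_trans _ _ (((2 * u) `^ a)%:E * (eta * u `^ (- s))%:E)%E).
  by apply: lee_wpmul2l; [rewrite lee_fin powR_ge0|exact: tail].
rewrite -EFinM lee_fin powRM ?(ltW u0)// -!mulrA ler_wpM2l ?powR_ge0//.
rewrite mulrCA ler_wpM2l// -powRD; last by rewrite (gt_eqF u0) implybT.
rewrite /u powRM ?exprn_ge0 ?(ltW y0)//.
by rewrite -powR_mulrn// -powR_mulrn ?powR_ge0// -!powRrM [J%:R * _]mulrC.
Qed.

(** For s < a the geometric sum is governed by its last block. With J least such that y 2^J >= N,
    the blocks end at most at 2 N, which costs one factor r. *)
Lemma truncated_moment_tail (a s : R) : 0 <= a -> s < a ->
  exists2 K : R, 0 <= K & forall eta y N : R, 0 <= eta -> 0 < y -> y <= N ->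
  (forall x, y <= x -> (Ex P (fun w => ((x <= Y w)%R%:R)%R) <= (eta * x `^ (- s))%:E)%E) ->
  (Ex P (fun w => (Y w `^ a * (y <= Y w < N)%R%:R)%R) <= (K * eta * N `^ (a - s))%:E)%E.
Proof.
move=> a0 sa; pose r := 2 `^ (a - s) : R.
have as0 : 0 < a - s by rewrite subr_gt0.
have pow1 : 1 `^ (a - s) = 1 :> R by rewrite powR1.
have r1 : 1 < r by rewrite -[ltLHS]pow1; apply: gt0_ltr_powR; rewrite ?nnegrE ?ltr1n.
exists (2 `^ a * (r / (r - 1))).
  by rewrite mulr_ge0 ?powR_ge0// divr_ge0// ?subr_ge0 ltW// (lt_trans ltr01).
move=> eta y N eta0 y0 yN tail.
have N0 : 0 < N by apply: lt_le_trans yN.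
have exJ : exists J, N <= y * 2 ^+ J.
  exists (Num.bound (N / y)); rewrite mulrC -ler_pdivrMr//.
  apply: ltW; apply: lt_trans (archi_boundP _) _; first by rewrite divr_ge0// ltW.
  by rewrite -natrX ltr_nat ltn_expl.
case: (ex_minnP exJ) => J NJ Jmin.
have J2N : y * 2 ^+ J <= 2 * N.
  case: J NJ Jmin => [|J] NJ Jmin.
    by rewrite expr0 mulr1 (le_trans yN)// ler_peMl ?ler1n// ltW.
  rewrite exprS mulrCA ler_wpM2l// leNgt; apply/negP => /ltW/Jmin.
  by rewrite ltnn.
apply: (@le_trans _ _ (Ex P (fun w => (Y w `^ a * (y <= Y w < y * 2 ^+ J)%R%:R)%R))).
  apply: Ex_le.
  - exact: measurable_funM.
  - exact: measurable_funM.
  - by move=> w; rewrite mulr_ge0 ?powR_ge0.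
  - move=> w; rewrite ler_wpM2l ?powR_ge0// ler_nat.
    case: (y <= Y w) => //=; case: (ltP (Y w) N) => // YN.
    by rewrite (lt_le_trans YN NJ).
apply: (le_trans (dyadic_moment J a0 eta0 y0 tail)); rewrite lee_fin.
have rsum : \sum_(j < J) r ^+ j <= r ^+ J / (r - 1).
  rewrite ler_pdivlMr ?subr_gt0// mulrC.
  have := subrX1 r J => <-; lra.
have E : y `^ (a - s) * r ^+ J = (y * 2 ^+ J) `^ (a - s).
  rewrite powRM ?exprn_ge0 ?(ltW y0)//; congr (_ * _).
  by rewrite -powR_mulrn ?powR_ge0// -powRrM mulrC powRrM powR_mulrn.
have E2 : (y * 2 ^+ J) `^ (a - s) <= r * N `^ (a - s).
  rewrite -powRM ?(ltW N0)//; apply: ge0_ler_powR; rewrite ?nnegrE ?(ltW as0)//.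
    by rewrite mulr_ge0 ?exprn_ge0// ltW.
  by rewrite mulr_ge0// ltW.
have ae0 : 0 <= 2 `^ a * eta by rewrite mulr_ge0// powR_ge0.
rewrite -mulrA.
apply: (@le_trans _ _ (2 `^ a * eta * (y `^ (a - s) * (r ^+ J / (r - 1))))).
  by rewrite ler_wpM2l// ler_wpM2l// powR_ge0.
rewrite [y `^ _ * _]mulrA E.
have -> : 2 `^ a * (r / (r - 1)) * eta * N `^ (a - s) =
  2 `^ a * eta * (r * N `^ (a - s) / (r - 1)) by ring.
by rewrite ler_wpM2l// ler_wpM2r// invr_ge0 subr_ge0 ltW.
Qed.

(** For a < s the geometric sum is governed by its first block, uniformly in the number of blocks;
    monotone convergence removes the upper cut. *)
Lemma upper_moment_tail (a s : R) : 0 <= a -> a < s ->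
  exists2 K : R, 0 <= K & forall eta y : R, 0 <= eta -> 0 < y ->
  (forall x, y <= x -> (Ex P (fun w => ((x <= Y w)%R%:R)%R) <= (eta * x `^ (- s))%:E)%E) ->
  (Ex P (fun w => (Y w `^ a * (y <= Y w)%R%:R)%R) <= (K * eta * y `^ (a - s))%:E)%E.
Proof.
move=> a0 sa; pose r := 2 `^ (a - s) : R.
have r0 : 0 < r by rewrite powR_gt0.
have r1 : r < 1.
  rewrite /r -opprB powRN invf_lt1 ?powR_gt0//.
  have pow1 : 1 `^ (s - a) = 1 :> R by rewrite powR1.
  by rewrite -[ltLHS]pow1; apply: gt0_ltr_powR; rewrite ?nnegrE ?subr_gt0 ?ltr1n.
exists (2 `^ a / (1 - r)).
  by rewrite divr_ge0 ?powR_ge0// subr_ge0 ltW.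
move=> eta y eta0 y0 tail.
pose G J w := (Y w `^ a * (y <= Y w < y * 2 ^+ J)%R%:R)%:E.
have GJ J : (Ex P (fun w => (Y w `^ a * (y <= Y w < y * 2 ^+ J)%R%:R)%R)
    <= (2 `^ a / (1 - r) * eta * y `^ (a - s))%:E)%E.
  apply: (le_trans (dyadic_moment J a0 eta0 y0 tail)); rewrite lee_fin.
  have -> : 2 `^ a / (1 - r) * eta * y `^ (a - s) =
    2 `^ a * eta * y `^ (a - s) * (1 - r)^-1 by ring.
  rewrite ler_wpM2l ?mulr_ge0 ?powR_ge0//.
  rewrite -[_^-1]mul1r ler_pdivlMr ?subr_gt0// mulrC.
  have := subrX1 r J; have : 0 <= r ^+ J by rewrite exprn_ge0// ltW.
  move: (r ^+ J) => t; rewrite -/r; set S := \sum_(i < J) _; nra.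
have exJ w : exists J, Y w < y * 2 ^+ J.
  exists (Num.bound (Y w / y)); rewrite mulrC -ltr_pdivrMr//.
  apply: lt_trans (archi_boundP _) _; first by rewrite divr_ge0// ltW.
  by rewrite -natrX ltr_nat ltn_expl.
have mono J J' : (J <= J')%N -> y * 2 ^+ J <= y * 2 ^+ J'.
  by move=> JJ; rewrite ler_wpM2l ?(ltW y0)// ler_weXn2l// ler1n.
have homoG w : {homo (fun J => G J w) : n k / (n <= k)%N >-> (n <= k)%E}.
  move=> n k nk; rewrite lee_fin ler_wpM2l ?powR_ge0// ler_nat.
  case: (y <= Y w) => //=; case: (ltP (Y w) (y * 2 ^+ n)) => // YN.
  by rewrite (lt_le_trans YN (mono _ _ nk)).
have mG J : measurable_fun setT (G J).
  by apply/measurable_EFinP; exact: measurable_funM.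
have G0 J w : (0 <= G J w)%E by rewrite lee_fin mulr_ge0// powR_ge0.
have limG w : limn (G ^~ w) = (Y w `^ a * (y <= Y w)%R%:R)%:E.
  have [J YJ] := exJ w.
  apply: lim_near_cst => //; exists J => // k /= Jk.
  by rewrite /G (lt_le_trans YJ (mono _ _ Jk)) andbT.
have -> : Ex P (fun w => (Y w `^ a * (y <= Y w)%R%:R)%R) = limn (fun J => \int[P]_w G J w)%E.
  rewrite -monotone_convergence//.
  by apply: eq_integral => w _; rewrite limG.
apply: lime_le.
  apply: ereal_nondecreasing_is_cvgn => n k nk.
  apply: ge0_le_integral => // w _; exact: homoG.
by apply: nearW => J; exact: GJ.
Qed.

End Dyadic.

(** * Asymptotics *)

Section Filters.
Context (R : realType).

Lemma cvg_pinfty0P (f : R -> R) : f x @[x --> +oo] --> (0 : R) <->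
  forall eps, 0 < eps -> exists M, forall x, M <= x -> `|f x| <= eps.
Proof.
split=> [/cvgrPdist_le H eps e0|H].
  have [M [_ HM]] := H _ e0; exists (M + 1) => x Mx.
  by have := HM x; rewrite sub0r normrN; apply; apply: lt_le_trans Mx; rewrite ltrDl.
apply/cvgrPdist_le => eps e0; have [M HM] := H _ e0.
exists M; split; first exact: num_real.
by move=> x Mx; rewrite sub0r normrN; apply: HM; exact: ltW.
Qed.

Lemma ereal_cvg_finP (f : nat -> \bar R) (c : R) : f n @[n --> \oo] --> c%:E <->
  forall eps, 0 < eps -> exists N, forall n, (N <= n)%N ->
    ((c - eps)%:E <= f n <= (c + eps)%:E)%E.
Proof.
split=> [/fine_cvgP[[N1 _ ffin] /cvgrPdist_le fc] eps e0|H].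
  have [N2 _ HN] := fc _ e0; exists (maxn N1 N2) => n.
  rewrite geq_max => /andP[n1 n2].
  have := HN n n2; rewrite /= -(fineK (ffin n n1)) !lee_fin distrC ler_distl.
  by rewrite fineK ?ffin.
apply/fine_cvgP; split.
  have [N HN] := H _ ltr01; exists N => // n /= Nn.
  have /andP[h1 h2] := HN n Nn; rewrite fin_numE; apply/andP; split; apply/eqP => E.
    by move: h1; rewrite E leeNy_eq.
  by move: h2; rewrite E leye_eq.
apply/cvgrPdist_le => eps e0; have [N HN] := H _ e0.
exists N => // n /= Nn; have := HN n Nn.
case: (f n) => [r|/andP[_]|/andP[]]; rewrite ?leye_eq ?leeNy_eq//.
by rewrite !lee_fin distrC ler_distl.
Qed.

Lemma exists_nat_ge (x : R) : exists2 n, (0 < n)%N & x <= n%:R.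
Proof.
exists (Num.bound x).+1 => //.
apply: (le_trans (ler_norm x)); apply: (le_trans (ltW (archi_boundP (normr_ge0 x)))).
have xb : (Num.bound `|x| <= Num.bound x)%N by rewrite /Num.bound normr_id.
by rewrite ler_nat leqW.
Qed.

End Filters.

(** * Bounds for E T_n^p in terms of the tail of X *)

Section Asymptotics.
Context (d : measure_display) (T : measurableType d) (R : realType).
Variable P : probability T R.
Variables (X : nat -> T -> R) (p : nat).
Hypotheses (iidX : iid P X) (X_gt0 : forall n w, 0 < X n w) (p_ge2 : (2 <= p)%N).
Hypothesis EX2_lty : (Ex P (fun w => (X 0%N w ^+ 2)%R) < +oo)%E.

Let mX i : measurable_fun setT (X i). Proof. by have [] := iidX. Qed.

Let X_ge0 i w : 0 <= X i w. Proof. exact: ltW. Qed.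

Let Y := X 0%N.
Let t (x : R) := tail P Y x.

Let mle (x : R) : measurable_fun setT (fun w => (x <= Y w)%R%:R : R).
Proof. by apply: measurable_fun_bool_natmul; apply: measurable_fun_ler => //; exact: mX. Qed.

Let mlt (x : R) : measurable_fun setT (fun w => (Y w < x)%R%:R : R).
Proof. by apply: measurable_fun_bool_natmul; apply: measurable_fun_ltr => //; exact: mX. Qed.

(** A zero integral would make f vanish outside a null set; as f never vanishes, that null set would
    be the whole space. *)
Lemma Ex_gt0 (f : T -> R) : measurable_fun setT f -> (forall w, 0 < f w) -> (0 < Ex P f)%E.
Proof.
move=> mf f0; rewrite lt0e Ex_ge0 ?andbT => [|w]; last exact: ltW.
apply/eqP => E0.
have mEf : measurable_fun setT (fun w => (f w)%:E) by exact/measurable_EFinP.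
have : (\int[P]_(w in setT) `|(f w)%:E| = 0)%E.
  by rewrite -E0; apply: eq_integral => w _; rewrite gee0_abs// lee_fin ltW.
move/(ae_eq_integral_abs P measurableT mEf) => [A [mA A0 sA]].
have AT : A = setT.
  apply/seteqP; split=> // w _; apply: sA => /(_ I) /= [] fw0.
  by have := f0 w; rewrite fw0 ltxx.
have A1 : P A = 1%E by rewrite AT; exact: probability_setT.
by have /eqP := etrans (esym A1) A0; rewrite onee_eq0.
Qed.

Lemma Ex_fin (f : T -> R) : (forall w, 0 <= f w) -> (Ex P f < +oo)%E ->
  Ex P f = (fine (Ex P f))%:E.
Proof. by move=> f0 ffin; rewrite fineK// ge0_fin_numE// Ex_ge0. Qed.

Let v := fine (Ex P (fun w => (Y w ^+ 2)%R)).
Let m := fine (Ex P Y).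

Let EY2 : Ex P (fun w => (Y w ^+ 2)%R) = v%:E.
Proof. by apply: Ex_fin => // w; exact: sqr_ge0. Qed.

Let EY : Ex P Y = m%:E.
Proof.
apply: Ex_fin => [w|]; first exact: X_ge0.
apply: (@le_lt_trans _ _ (Ex P (fun w => (1 + Y w ^+ 2)%R))).
  apply: Ex_le.
  - exact: mX.
  - by apply: measurable_funD => //; apply: measurable_funX; exact: mX.
  - by move=> w; exact: X_ge0.
  - by move=> w; have := sqr_ge0 (Y w - 1); rewrite !expr2; have := X_ge0 0%N w; rewrite -/Y; nra.
rewrite ExD// ?Ex_cst ?EY2 -?EFinD ?ltry//.
- by apply: measurable_funX; exact: mX.
- by move=> w; exact: sqr_ge0.
Qed.

Let m_gt0 : 0 < m.
Proof.
by rewrite -lte_fin -EY; apply: Ex_gt0 => [|w]; [exact: mX|exact: X_gt0].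
Qed.

Let v_gt0 : 0 < v.
Proof.
rewrite -lte_fin -EY2; apply: Ex_gt0 => [|w]; last by rewrite exprn_gt0// X_gt0.
by apply: measurable_funX; exact: mX.
Qed.

Let mu := ratio_limit P Y.

Let muE : mu = v / m. Proof. by []. Qed.

Let mu_ge0 : 0 <= mu. Proof. by rewrite muE; apply: divr_ge0; exact: ltW. Qed.

Let Et x : Ex P (fun w => ((x <= Y w)%R%:R)%R) = (t x)%:E.
Proof.
pose A := [set w | x <= Y w].
have mA : measurable A.
  rewrite (_ : A = setT `&` Y @^-1` `[x, +oo[).
    by apply: mX => //; exact: measurable_itv.
  by apply/seteqP; split => [w /= xw|w /= [_]]; rewrite in_itv /= andbT.
rewrite /t /tail -/A fineK ?fin_num_measure// -[in RHS](setIT A) -integral_indic//.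
apply: eq_integral => w _; rewrite indicE; congr ((nat_of_bool _)%:R%:E).
by apply/idP/idP => [xw|/set_mem]; [exact/mem_set|].
Qed.
Let t_ge0 x : 0 <= t x. Proof. by rewrite -lee_fin -Et; apply: Ex_ge0. Qed.

Let t_le x y : x <= y -> t y <= t x.
Proof.
move=> xy; rewrite -lee_fin -!Et; apply: Ex_le => // w.
by rewrite ler_nat; case: (leP y (Y w)) => // yY; rewrite (le_trans xy yY).
Qed.

Let t_markov x : 0 <= x -> x ^+ 2 * t x <= v.
Proof.
move=> x0; rewrite -lee_fin EFinM -Et -EY2 -ExZ ?sqr_ge0//.
apply: Ex_le.
- exact: measurable_funM.
- by apply: measurable_funX; exact: mX.
- by move=> w; rewrite mulr_ge0// sqr_ge0.
- move=> w; case: (leP x (Y w)) => xY; last by rewrite mulr0 sqr_ge0.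
  by rewrite mulr1 lerXn2r// nnegrE ?X_ge0.
Qed.

(** Monotone convergence in the cut-off level. It serves for x^2, to choose [kap], and for x^(p+1),
    to bound the tail by a moment. *)
Lemma truncation_cvg (f : R -> R) (c : R) : measurable_fun setT f -> (forall x, 0 <= f x) ->
  Ex P (fun w => (f (Y w))%R) = c%:E -> forall del, 0 < del -> exists2 K, (0 < K)%N &
  ((c - del)%:E <= Ex P (fun w => (f (Y w) * (Y w < K%:R)%R%:R)%R))%E.
Proof.
move=> mf f0 Ec del d0.
pose G (K : nat) w := (f (Y w) * (Y w < K%:R)%R%:R)%:E.
have mfY : measurable_fun setT (fun w => f (Y w)) by apply: measurableT_comp => //; exact: mX.
have mG K : measurable_fun setT (G K).
  by apply/measurable_EFinP; exact: measurable_funM.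
have G0 K w : (0 <= G K w)%E by rewrite lee_fin mulr_ge0.
have homoG w : {homo (fun K => G K w) : n k / (n <= k)%N >-> (n <= k)%E}.
  move=> n k nk; rewrite lee_fin ler_wpM2l// ler_nat.
  case: (ltP (Y w) n%:R) => // Yn.
  by rewrite (lt_le_trans Yn)// ler_nat.
have limG w : limn (G ^~ w) = (f (Y w))%:E.
  have [N N0 YN] := exists_nat_ge (Y w + 1).
  apply: lim_near_cst => //; exists N => // k /= Nk.
  have Yk : Y w < k%:R.
    apply: (@lt_le_trans _ _ (Y w + 1)); first by rewrite ltrDl.
    by rewrite (le_trans YN)// ler_nat.
  by rewrite /G Yk mulr1.
have := @cvg_monotone_convergence _ _ _ P _ measurableT _ mG (fun n x _ => G0 n x)
  (fun x _ => homoG x).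
have -> : (\int[P]_x (fun x0 => limn (G ^~ x0)) x)%E = c%:E.
  by rewrite -Ec; apply: eq_integral => w _; rewrite limG.
move=> /ereal_cvg_finP/(_ _ d0)[N HN].
exists N.+1 => //.
by have /andP[] := HN N.+1 (leqnSn N).
Qed.

(** The coefficient of the jump term in [ETp_lower] after n^p is taken out. *)
Let c0 := 4^-1 * (1 + 4 * m)^-1 ^+ p.

Let c0_gt0 : 0 < c0.
Proof.
rewrite mulr_gt0 ?invr_gt0// exprn_gt0// invr_gt0 addr_gt0// mulr_gt0//.
Qed.

Lemma ETp_lower_eventually (kap : R -> R) (kb D : R) :
  measurable_fun setT kap -> (forall u, 0 <= kap u <= u ^+ 2) ->
  Ex P (fun w => (kap (Y w))%R) = kb%:E -> Ex P (fun w => (kap (Y w) * Y w)%R) = D%:E ->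
  exists C : R, exists N, forall n, (N <= n)%N ->
  ((p%:R * mu ^+ p.-1 / m * kb - p.-1%:R * mu ^+ p - C / n%:R
     + c0 * (n%:R ^+ p.+1 * t n%:R))%:E <= ETp P X p n)%E.
Proof.
move=> mk kap2 Ekb ED.
pose L := 2 * p%:R * mu ^+ p.-1.
have L0 : 0 <= L by rewrite !mulr_ge0// exprn_ge0.
have m1 : 0 < 1 + 4 * m by rewrite addr_gt0// mulr_gt0.
(* The first summand makes n / (1 + 4 m) at least 1 + L, hence its power p - 1 at least L; the
   second gives n t(n) <= v / n <= 1/4 by Chebyshev's inequality. *)
have [N N0 HN] := exists_nat_ge ((1 + 4 * m) * (1 + L) + 4 * v).
exists (p%:R * mu ^+ p.-1 / m ^+ 2 * D), N => n Nn.
have n0 : (0 < n)%N by exact: leq_trans Nn.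
have n0' : 0 < n%:R :> R by rewrite ltr0n.
have nb : (1 + 4 * m) * (1 + L) + 4 * v <= n%:R by rewrite (le_trans HN)// ler_nat.
have m1L : 0 <= (1 + 4 * m) * (1 + L) by rewrite mulr_ge0 ?(ltW m1)// addr_ge0.
have hN : L <= (n%:R / (1 + 4 * m)) ^+ p.-1.
  have b1 : 1 + L <= n%:R / (1 + 4 * m).
    rewrite ler_pdivlMr// mulrC; apply: le_trans nb; rewrite lerDl mulr_ge0// ltW//.
  have b2 : 1 <= n%:R / (1 + 4 * m) by apply: le_trans b1; rewrite lerDl.
  apply: (@le_trans _ _ (n%:R / (1 + 4 * m))); first by apply: le_trans b1; rewrite lerDr.
  by rewrite -[leLHS]expr1; apply: ler_weXn2l => //; case: p p_ge2 => [|[]].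
have ht : n%:R * t n%:R <= 4^-1.
  have h := t_markov (ltW n0').
  have v4 : 4 * v <= n%:R by apply: le_trans nb; rewrite lerDr.
  rewrite -(ler_pM2l n0'); apply: (@le_trans _ _ v); first by move: h; rewrite expr2 mulrA.
  lra.
have := @ETp_lower _ _ _ P X m iidX X_gt0 EY m_gt0 kap kb D mu (t n%:R) p n p_ge2 n0
  mk kap2 mu_ge0 Ekb ED (Et _) hN ht.
rewrite -leeBlDr// -EFinB; apply: le_trans; rewrite lee_fin.
have -> : 4^-1 * (n%:R / (1 + 4 * m)) ^+ p * (n%:R * t n%:R) = c0 * (n%:R ^+ p.+1 * t n%:R).
  by rewrite /c0 exprMn exprS; ring.
have -> : p%:R * mu ^+ p.-1 / m ^+ 2 * (D / n%:R) = p%:R * mu ^+ p.-1 / m ^+ 2 * D / n%:R.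
  by rewrite mulrA.
lra.
Qed.

(** With the full second moment v in place of kb, the tangent bound is exact to leading order, since
    mu is the point of tangency. *)
Let tangent_value : p%:R * mu ^+ p.-1 / m * v - p.-1%:R * mu ^+ p = mu ^+ p.
Proof.
have E : p%:R * mu ^+ p.-1 / m * v = p%:R * mu ^+ p.
  rewrite -mulrA [m^-1 * v]mulrC -muE -mulrA -exprSr prednK//.
  by case: p p_ge2.
rewrite E -mulrBl.
have -> : p%:R - p.-1%:R = 1 :> R; last by rewrite mul1r.
by case: p p_ge2 => // q _; rewrite -natr1 /=; ring.
Qed.

(** Here [kap] is x^2 cut off at a level K: its mean is close to v and kap(X) X is at most K^3, so a
    second moment is enough. No tail assumption enters, and the jump term is retained because it
    later yields the tail condition. *)
Lemma ETp_lower_qualitative (eps : R) : 0 < eps -> exists N, forall n, (N <= n)%N ->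
  ((mu ^+ p - eps + c0 * (n%:R ^+ p.+1 * t n%:R))%:E <= ETp P X p n)%E.
Proof.
move=> e0.
pose B := p%:R * mu ^+ p.-1 / m.
have B0 : 0 <= B by rewrite !mulr_ge0 ?exprn_ge0 ?invr_ge0// ltW.
have B1 : 0 < B + 1 by rewrite ltr_wpDl.
(* Lowering the mean of [kap] by this amount costs at most eps / 2 after multiplication by B; B + 1
   keeps the denominator positive. The other eps / 2 absorbs C / n. *)
have del0 : 0 < eps / 2 / (B + 1) by rewrite !divr_gt0.
have sq0 (x : R) : 0 <= x ^+ 2 by exact: sqr_ge0.
have msq : measurable_fun setT (fun x : R => x ^+ 2) by exact: exprn_measurable.
have [K K0 HK] := truncation_cvg msq sq0 EY2 del0.
pose kap (x : R) := x ^+ 2 * (x < K%:R)%R%:R.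
have mk : measurable_fun setT kap.
  apply: measurable_funM; first exact: exprn_measurable.
  by apply: measurable_fun_bool_natmul; exact: measurable_fun_ltr.
have kap2 u : 0 <= kap u <= u ^+ 2.
  by rewrite /kap; case: (u < K%:R); rewrite ?mulr1 ?mulr0 ?lexx sqr_ge0.
have mkY : measurable_fun setT (fun w => kap (Y w)) by apply: measurableT_comp => //; exact: mX.
have kY0 w : 0 <= kap (Y w) by have /andP[] := kap2 (Y w).
have Ekb : Ex P (fun w => (kap (Y w))%R) = (fine (Ex P (fun w => (kap (Y w))%R)))%:E.
  apply: Ex_fin => //; apply: le_lt_trans EX2_lty; apply: Ex_le => //.
  - by apply: measurable_funX; exact: mX.
  - by move=> w; have /andP[] := kap2 (Y w).
have ED : Ex P (fun w => (kap (Y w) * Y w)%R) = (fine (Ex P (fun w => (kap (Y w) * Y w)%R)))%:E.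
  apply: Ex_fin => [w|]; first by rewrite mulr_ge0 ?kY0 ?X_ge0.
  apply: (@le_lt_trans _ _ (Ex P (fun=> K%:R ^+ 3))); last by rewrite Ex_cst ltry.
  apply: Ex_le => //.
  - by apply: measurable_funM => //; exact: mX.
  - by move=> w; rewrite mulr_ge0 ?kY0 ?X_ge0.
  - move=> w; rewrite /kap; case: (ltP (Y w) K%:R) => YK.
      by rewrite mulr1 -exprSr lerXn2r ?nnegrE ?X_ge0 ?(ltW YK).
    by rewrite mulr0 mul0r exprn_ge0.
have [C [N HN]] := ETp_lower_eventually mk kap2 Ekb ED.
have [N' N'0 HN'] := exists_nat_ge (2 * `|C| / eps).
exists (maxn N N') => n; rewrite geq_max => /andP[Nn N'n].
apply: le_trans (HN n Nn); rewrite lee_fin lerD2r.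
have n0' : 0 < n%:R :> R by rewrite ltr0n (leq_trans N'0).
have Cn : C / n%:R <= eps / 2.
  rewrite ler_pdivrMr//.
  have : 2 * `|C| / eps <= n%:R by rewrite (le_trans HN')// ler_nat.
  rewrite ler_pdivrMr//; have := ler_norm C; lra.
have kbl : v - eps / 2 / (B + 1) <= fine (Ex P (fun w => (kap (Y w))%R)).
  by rewrite -lee_fin -Ekb.
have h : B * (eps / 2 / (B + 1)) <= eps / 2.
  rewrite mulrA ler_pdivrMr// mulrC ler_wpM2l ?lerDl// divr_ge0// ltW//.
have tv := tangent_value; rewrite -/B in tv *.
have := ler_wpM2l B0 kbl; rewrite mulrBr; lra.
Qed.

(** Since sig <= 1/2 and p >= 2, one has p + 1 + sig < 2p and 3 + sig < 4, so the truncated moments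
    of orders 2p and 4 are governed by the level n and the moment of order p above n by the tail.
    The condition C * E <= 1 provides the e <= 1 required by [ETp_upper]. *)
Lemma ETp_upper_tail (sig : R) : 0 <= sig <= 2^-1 -> exists2 C : R, 0 <= C &
  forall (eta y : R), 0 <= eta -> 1 <= y ->
  (forall x, y <= x -> t x <= eta * x `^ (- (p%:R + 1 + sig))) ->
  forall n, y <= n%:R ->
  let E := y ^+ (2 * p) / n%:R + eta * n%:R `^ (- sig) in
  C * E <= 1 -> (ETp P X p n <= (mu ^+ p + C * E)%:E)%E.
Proof.
move=> /andP[s0 s1].
have p2' : 2 <= p%:R :> R by rewrite ler_nat.
have mY : measurable_fun setT Y by exact: mX.
have Y0 w : 0 < Y w by exact: X_gt0.
have a10 : 0 <= (2 * p)%:R :> R by [].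
have pD : (2 * p)%:R = p%:R + p%:R :> R by rewrite mul2n -addnn natrD.
have sa1 : p%:R + 1 + sig < (2 * p)%:R :> R by rewrite pD; lra.
have [K1 K10 HK1] := truncated_moment_tail P mY Y0 a10 sa1.
have a20 : 0 <= 4%:R :> R by [].
have sa2 : 3 + sig < 4%:R :> R by lra.
have [K2 K20 HK2] := truncated_moment_tail P mY Y0 a20 sa2.
have sa3 : p%:R < p%:R + 1 + sig :> R by lra.
have [K3 K30 HK3] := upper_moment_tail P mY Y0 (ler0n R p) sa3.
have p0 : (0 < p)%N by exact: leq_trans p_ge2.
have [C0 C00 HC0] := ETp_upper iidX X_gt0 EY EY2 m_gt0 v_gt0 p0.
pose C1 := 2 * (1 + K1 + K2).
have C10 : 0 <= C1 by rewrite mulr_ge0// !addr_ge0.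
exists (K3 + C0 * (C1 + 1) + C1).
  by rewrite !addr_ge0// mulr_ge0// addr_ge0.
move=> eta y eta0 y1 tailb n yn E CE.
have y0 : 0 < y by exact: lt_le_trans y1.
have n0' : 0 < n%:R :> R by exact: lt_le_trans yn.
have n0 : (0 < n)%N by rewrite -(ltr0n R).
have n1 : 1 <= n%:R :> R by exact: le_trans yn.
pose ns := n%:R `^ (- sig) : R.
have ns0 : 0 <= ns by exact: powR_ge0.
have yp0 : 0 <= y ^+ (2 * p) by rewrite exprn_ge0// ltW.
have yp1 : 1 <= y ^+ (2 * p) by rewrite exprn_ege1.
have nsE (a : R) : n%:R `^ (a - sig) = n%:R `^ a * ns.
  by rewrite powRD// (gt_eqF n0') implybT.
pose t1 := y ^+ (2 * p) / n%:R; pose t2 := eta * ns.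
have t10 : 0 <= t1 by rewrite divr_ge0// ltW.
have t20 : 0 <= t2 by rewrite mulr_ge0.
have EE : E = t1 + t2 by [].
have tb1 x : y <= x -> (Ex P (fun w => ((x <= Y w)%R%:R)%R) <= (eta * x `^ (- (p%:R + 1 + sig)))%:E)%E.
  by move=> yx; rewrite Et lee_fin; exact: tailb.
(* As y >= 1 and p >= 2, the exponent may be weakened to 3 + sig; the truncated fourth moment is
   then of order n * n^-sig whatever p is. *)
have tb2 x : y <= x -> (Ex P (fun w => ((x <= Y w)%R%:R)%R) <= (eta * x `^ (- (3 + sig)))%:E)%E.
  move=> yx; apply: (le_trans (tb1 x yx)); rewrite lee_fin ler_wpM2l// ler_powR//.
    exact: le_trans yx.
  lra.
have tb3 x : n%:R <= x -> (Ex P (fun w => ((x <= Y w)%R%:R)%R) <= (eta * x `^ (- (p%:R + 1 + sig)))%:E)%E.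
  by move=> nx; apply: tb1; exact: le_trans nx.
(* No tail bound is available below y, where Y^a <= y^a is used instead. *)
have trunc (a : nat) (K s : R) :
    (Ex P (fun w => (Y w `^ a%:R * (y <= Y w < n%:R)%R%:R)%R) <= K%:E)%E ->
    (Ex P (fun w => (Y w ^+ a * (Y w < n%:R)%R%:R)%R) <= (y ^+ a + K)%:E)%E.
  move=> HK.
  have mY1 : measurable_fun setT (fun w => Y w `^ a%:R * (y <= Y w < n%:R)%R%:R).
    apply: measurable_funM; first exact: (measurableT_comp (@measurable_powR R a%:R) mY).
    by apply: measurable_fun_bool_natmul; apply: measurable_and;
      [exact: measurable_fun_ler|exact: measurable_fun_ltr].
  have Y10 w : 0 <= Y w `^ a%:R * (y <= Y w < n%:R)%R%:R by rewrite mulr_ge0// powR_ge0.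
  have ya0 : 0 <= y ^+ a by rewrite exprn_ge0// ltW.
  apply: (@le_trans _ _ (Ex P (fun w => (y ^+ a + Y w `^ a%:R * (y <= Y w < n%:R)%R%:R)%R))).
    apply: Ex_le.
    - by apply: measurable_funM => //; exact: measurable_funX.
    - exact: measurable_funD.
    - by move=> w; rewrite mulr_ge0// exprn_ge0// ltW.
    - move=> w; rewrite powR_mulrn ?(ltW (Y0 w))//; case: (leP y (Y w)) => yY /=.
        by rewrite lerDr.
      rewrite mulr0 addr0; apply: (@le_trans _ _ (Y w ^+ a)).
        by rewrite ler_piMr ?exprn_ge0 ?(ltW (Y0 w))// lern1 leq_b1.
      by rewrite lerXn2r ?nnegrE ?(ltW (Y0 w)) ?(ltW y0) ?(ltW yY).
  by rewrite ExD// Ex_cst EFinD leeD2l.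
have M1 := trunc (2 * p)%N _ 0 (HK1 eta y n%:R eta0 y0 yn tb1).
have M2 := trunc 4%N _ 0 (HK2 eta y n%:R eta0 y0 yn tb2).
have q1 : n%:R `^ ((2 * p)%:R - (p%:R + 1 + sig)) = n%:R ^+ p.-1 * ns.
  have -> : (2 * p)%:R - (p%:R + 1 + sig) = p.-1%:R - sig.
    have : p%:R = p.-1%:R + 1 :> R by rewrite natr1 prednK.
    by rewrite pD; lra.
  by rewrite nsE powR_mulrn// ltW.
have q2 : n%:R `^ (4%:R - (3 + sig)) = n%:R * ns.
  have -> : 4%:R - (3 + sig) = 1 - sig by lra.
  by rewrite nsE powRr1// ltW.
have q3 : n%:R * n%:R `^ (p%:R - (p%:R + 1 + sig)) = ns.
  have -> : p%:R - (p%:R + 1 + sig) = -1 - sig by lra.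
  by rewrite nsE mulrA powR_inv1 ?(ltW n0')// divff ?gt_eqF// mul1r.
rewrite q1 in M1; rewrite q2 in M2.
pose e := C1 * E.
have E0 : 0 <= E by rewrite EE addr_ge0.
have e01 : 0 <= e <= 1.
  rewrite /e mulr_ge0//=; apply: le_trans CE; rewrite ler_wpM2r// lerDr.
  by rewrite addr_ge0// mulr_ge0// addr_ge0.
have he k : (0 < k < p)%N ->
    (Ex P (fun w => ((Y w ^+ 2 * (Y w < n%:R)%R%:R) ^+ k.+1)%R) <= (e * n%:R ^+ k)%:E)%E.
  move=> /andP[k0 kp].
  have nk0 : 0 <= n%:R ^+ k :> R by exact: exprn_ge0.
  have np0 : 0 < n%:R ^+ p.-1 :> R by exact: exprn_gt0.
  pose A w := Y w ^+ 4 * (Y w < n%:R)%R%:R.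
  pose B w := Y w ^+ (2 * p) * (Y w < n%:R)%R%:R.
  have mA : measurable_fun setT A by apply: measurable_funM => //; exact: measurable_funX.
  have mB : measurable_fun setT B by apply: measurable_funM => //; exact: measurable_funX.
  have A0 w : 0 <= A w by rewrite mulr_ge0// exprn_ge0// ltW.
  have B0 w : 0 <= B w by rewrite mulr_ge0// exprn_ge0// ltW.
  have i0 : 0 <= n%:R^-1 :> R by rewrite invr_ge0 ltW.
  have j0 : 0 <= (n%:R ^+ p.-1)^-1 :> R by rewrite invr_ge0 ltW.
  have mA' : measurable_fun setT (fun w => n%:R^-1 * A w) by exact: measurable_funM.
  have mB' : measurable_fun setT (fun w => (n%:R ^+ p.-1)^-1 * B w) by exact: measurable_funM.
  have A'0 w : 0 <= n%:R^-1 * A w by rewrite mulr_ge0.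
  have B'0 w : 0 <= (n%:R ^+ p.-1)^-1 * B w by rewrite mulr_ge0.
  apply: (@le_trans _ _ (Ex P (fun w => (n%:R ^+ k * (n%:R^-1 * A w + (n%:R ^+ p.-1)^-1 * B w))%R))).
    apply: Ex_le.
    - apply: measurable_funX; apply: measurable_funM => //; exact: measurable_funX.
    - by apply: measurable_funM => //; exact: measurable_funD.
    - by move=> w; rewrite exprn_ge0// mulr_ge0// exprn_ge0// ltW.
    - move=> w; rewrite /A /B; case: (Y w < n%:R); last first.
        by rewrite !mulr0 expr0n /= addr0 mulr0.
      rewrite !mulr1.
      (* For Y^2 / n, the powers from 1 to p - 1 are dominated by the two extreme ones; after
         multiplication by n^k Y^2 only the orders 4 and 2p remain. *)
      have := @exprn_le_interpolate R (Y w ^+ 2 / n%:R) k p.-1.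
      rewrite divr_ge0 ?sqr_ge0 ?(ltW n0')// => /(_ isT).
      rewrite k0 -ltnS prednK// kp => /(_ isT) H.
      have := ler_wpM2l (mulr_ge0 nk0 (sqr_ge0 (Y w))) H.
      have -> : n%:R ^+ k * Y w ^+ 2 * (Y w ^+ 2 / n%:R) ^+ k = (Y w ^+ 2) ^+ k.+1.
        have nn : n%:R ^+ k * n%:R^-1 ^+ k = 1 :> R by rewrite -exprMn divff ?expr1n// gt_eqF.
        rewrite exprMn (exprS (Y w ^+ 2) k); transitivity ((n%:R ^+ k * n%:R^-1 ^+ k) * (Y w ^+ 2 * (Y w ^+ 2) ^+ k)).
          by move: (n%:R^-1 ^+ k : R) ((Y w ^+ 2) ^+ k) (n%:R ^+ k : R) => *; ring.
        by rewrite nn mul1r.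
      have -> : n%:R ^+ k * Y w ^+ 2 * (Y w ^+ 2 / n%:R + (Y w ^+ 2 / n%:R) ^+ p.-1) =
         n%:R ^+ k * (n%:R^-1 * Y w ^+ 4 + (n%:R ^+ p.-1)^-1 * Y w ^+ (2 * p)).
        have -> : Y w ^+ (2 * p) = Y w ^+ 2 * (Y w ^+ 2) ^+ p.-1.
          by rewrite -exprS prednK// exprM.
        rewrite exprMn exprVn.
        by move: (n%:R^-1 : R) ((Y w ^+ 2) ^+ p.-1) ((n%:R ^+ p.-1)^-1 : R) (n%:R ^+ k : R) => *; ring.
      by [].
  rewrite (@ExZ _ _ _ P (fun w => n%:R^-1 * A w + (n%:R ^+ p.-1)^-1 * B w))//; last 2 first.
  - exact: measurable_funD.
  - by move=> w; rewrite addr_ge0.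
  rewrite ExD// (@ExZ _ _ _ P A)// (@ExZ _ _ _ P B)//.
  rewrite [e * _]mulrC EFinM; apply: lee_wpmul2l => //.
  apply: (@le_trans _ _ ((n%:R^-1)%:E * (y ^+ 4 + K2 * eta * (n%:R * ns))%:E +
    ((n%:R ^+ p.-1)^-1)%:E * (y ^+ (2 * p) + K1 * eta * (n%:R ^+ p.-1 * ns))%:E)%E).
    by apply: leeD; apply: lee_wpmul2l.
  rewrite -!EFinM -EFinD lee_fin.
  have -> : n%:R^-1 * (y ^+ 4 + K2 * eta * (n%:R * ns)) = n%:R^-1 * y ^+ 4 + K2 * t2.
    by rewrite /t2; field; rewrite gt_eqF.
  have -> : (n%:R ^+ p.-1)^-1 * (y ^+ (2 * p) + K1 * eta * (n%:R ^+ p.-1 * ns)) =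
      (n%:R ^+ p.-1)^-1 * y ^+ (2 * p) + K1 * t2.
    by rewrite /t2; field; rewrite expf_neq0// gt_eqF.
  have h1 : n%:R^-1 * y ^+ 4 <= t1.
    have p4 : (4 <= 2 * p)%N by rewrite -[4%N]/(2 * 2)%N leq_pmul2l.
    by rewrite /t1 [leRHS]mulrC ler_wpM2l// ler_weXn2l.
  have h2 : (n%:R ^+ p.-1)^-1 * y ^+ (2 * p) <= t1.
    rewrite /t1 [leRHS]mulrC ler_wpM2r// lef_pV2 ?posrE//.
    by rewrite -[leLHS]expr1; apply: ler_weXn2l => //; rewrite -ltnS prednK.
  rewrite /e /C1 EE.
  have : 0 <= (K1 + K2) * t1 by rewrite mulr_ge0// addr_ge0.
  have : 0 <= (K1 + K2) * t2 by rewrite mulr_ge0// addr_ge0.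
  lra.
apply: (le_trans (HC0 n e n0 e01 he)).
have M3 := HK3 eta n%:R eta0 n0' tb3.
apply: (@le_trans _ _ (n%:R%:E * (K3 * eta * n%:R `^ (p%:R - (p%:R + 1 + sig)))%:E +
   ((v / m) ^+ p + C0 * (e + n%:R^-1))%:E)%E).
  apply: leeD => //; apply: lee_wpmul2l => //.
  apply: le_trans M3; rewrite le_eqVlt; apply/orP; left; apply/eqP; apply: eq_Ex => w.
  by rewrite powR_mulrn// ltW.
rewrite -EFinM -EFinD lee_fin.
have -> : n%:R * (K3 * eta * n%:R `^ (p%:R - (p%:R + 1 + sig))) = K3 * t2.
  by rewrite /t2 -q3; ring.
rewrite -muE /e.
have nE : n%:R^-1 <= E.
  rewrite EE -[leLHS]addr0 lerD// /t1 -[leLHS]mul1r ler_wpM2r// invr_ge0 ltW//.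
have h1 := ler_wpM2l C00 nE.
have h2 : K3 * t2 <= K3 * E by rewrite ler_wpM2l// EE lerDr.
have h3 : 0 <= C1 * E by rewrite mulr_ge0.
lra.
Qed.

(** * The implications between convergence, tails and moments *)

Let otail := x ^+ p.+1 * t x @[x --> +oo] --> (0 : R).
Let conv := ETp P X p n @[n --> \oo] --> (mu ^+ p)%:E.

Let powR_tail (x eta : R) : 0 < x -> x ^+ p.+1 * t x <= eta ->
  t x <= eta * x `^ (- (p%:R + 1 + 0)).
Proof.
move=> x0 h; have xp : 0 < x ^+ p.+1 by exact: exprn_gt0.
by rewrite addr0 natr1 powRN powR_mulrn ?(ltW x0)// ler_pdivlMr// mulrC.
Qed.

(** The lower bound contains c0 n^(p+1) t(n) on top of nearly mu^p, so convergence to mu^p forces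
    this term to vanish. *)
Lemma conv_otail : conv -> otail.
Proof.
move=> /ereal_cvg_finP cv; apply/cvg_pinfty0P => eps e0.
(* The two bounds on E T_n^p leave at most 2 e for the jump term; the power of 2 prepares the
   passage from integers to reals. *)
pose e := c0 * eps / (2 * 2 ^+ p.+1).
have pp : 0 < 2 ^+ p.+1 :> R by rewrite exprn_gt0.
have ee0 : 0 < e by rewrite divr_gt0// mulr_gt0.
have [N1 HN1] := ETp_lower_qualitative ee0.
have [N2 HN2] := cv _ ee0.
exists (maxn N1 (maxn N2 1)).+1%:R => x Nx.
have x0 : 0 <= x by apply: le_trans Nx.
(* The integer part satisfies n >= 1, so x <= 2 n, and t is nonincreasing: replacing x by n costs a
   factor 2^(p+1). *)
pose n := Num.truncn x.
have /andP[nx xn] : n%:R <= x < n.+1%:R by exact: truncn_itv.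
have : (maxn N1 (maxn N2 1) <= n)%N.
  by rewrite -ltnS -(ltr_nat R) (le_lt_trans _ xn)// (le_trans _ Nx)// ler_nat.
rewrite !geq_max => /andP[n1 /andP[n2 n0]].
rewrite ger0_norm ?mulr_ge0 ?exprn_ge0//.
have /andP[_ h2] := HN2 n n2.
have := le_trans (HN1 n n1) h2; rewrite lee_fin => h.
have h3 : c0 * (n%:R ^+ p.+1 * t n%:R) <= 2 * e by lra.
have h4 : n%:R ^+ p.+1 * t n%:R <= eps / 2 ^+ p.+1.
  rewrite -(ler_pM2l c0_gt0); apply: (le_trans h3).
  by rewrite le_eqVlt; apply/orP; left; apply/eqP; rewrite /e; field; rewrite gt_eqF.
apply: (@le_trans _ _ (2 ^+ p.+1 * (n%:R ^+ p.+1 * t n%:R))); last first.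
  by move: h4; rewrite ler_pdivlMr// mulrC.
rewrite mulrA -exprMn; apply: ler_pM; rewrite ?exprn_ge0// ?t_le//.
rewrite lerXn2r ?nnegrE ?mulr_ge0// (le_trans (ltW xn))// -natrM ler_nat.
by rewrite mul2n -addnn -addn1 leq_add2l.
Qed.

Lemma otail_conv : otail -> conv.
Proof.
move=> /cvg_pinfty0P ot; apply/ereal_cvg_finP => eps e0.
have s01 : 0 <= (0 : R) <= 2^-1 by rewrite lexx invr_ge0 ler0n.
have [C C0 HC] := ETp_upper_tail s01.
have C1 : 0 < 2 * (C + 1) by rewrite mulr_gt0// ltr_wpDl.
pose e := Num.min eps 1.
have ee0 : 0 < e by rewrite lt_min e0 ltr01.
have e1 : e <= 1 by rewrite ge_min lexx orbT.
have ee : e <= eps by rewrite ge_min lexx.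
(* At sig = 0 the error is C (y^(2p) / n + eta). With y fixed by eta, large n makes the first part
   at most eta, and C (eta + eta) <= e. The cap e <= 1 meets the smallness condition of the upper
   bound. *)
pose eta := e / (2 * (C + 1)).
have eta0 : 0 < eta by rewrite divr_gt0.
have [M HM] := ot _ eta0.
pose y := Num.max M 1.
have y1 : 1 <= y by rewrite le_max lexx orbT.
have tl x : y <= x -> t x <= eta * x `^ (- (p%:R + 1 + 0)).
  rewrite ge_max => /andP[Mx x1]; apply: powR_tail => //; first exact: lt_le_trans x1.
  by apply: le_trans (HM x Mx); exact: ler_norm.
have [N1 HN1] := ETp_lower_qualitative e0.
have [N2 N20 HN2] := exists_nat_ge (y + y ^+ (2 * p) / eta).
exists (maxn N1 N2) => n; rewrite geq_max => /andP[n1 n2].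
have n0 : 0 < n%:R :> R by rewrite ltr0n (leq_trans N20).
have nb : y + y ^+ (2 * p) / eta <= n%:R by rewrite (le_trans HN2)// ler_nat.
have yp0 : 0 <= y ^+ (2 * p) by rewrite exprn_ge0// (le_trans ler01).
have yn : y <= n%:R by apply: le_trans nb; rewrite lerDl divr_ge0// ltW.
apply/andP; split.
  apply: le_trans (HN1 n n1); rewrite lee_fin lerDl mulr_ge0// ?(ltW c0_gt0)//.
  by rewrite mulr_ge0// exprn_ge0.
have := HC eta y (ltW eta0) y1 tl n yn.
rewrite oppr0 powRr0 mulr1.
have E1 : C * (y ^+ (2 * p) / n%:R + eta) <= e.
  have h : y ^+ (2 * p) / n%:R <= eta.
    rewrite ler_pdivrMr// -ler_pdivrMl// mulrC; apply: le_trans nb.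
    by rewrite lerDr (le_trans ler01).
  apply: (@le_trans _ _ (C * (eta + eta))); first by rewrite ler_wpM2l// lerD2r.
  have -> : C * (eta + eta) = C / (C + 1) * e by rewrite /eta; field; rewrite gt_eqF// ltr_wpDl.
  by rewrite ler_piMl ?(ltW ee0)// ler_pdivrMr ?mul1r ?lerDl// ltr_wpDl.
move=> /(_ (le_trans E1 e1)) /le_trans; apply.
by rewrite lee_fin lerD2l (le_trans E1).
Qed.

(** For x >= K the events X < K and X >= x are disjoint, so x^(p+1) t(x) is at most what the
    truncation at K misses of the moment. *)
Lemma moment_otail : (moment P Y (p.+1)%:R < +oo)%E -> otail.
Proof.
move=> mfin; apply/cvg_pinfty0P => eps e0.
have mpow : measurable_fun setT (fun x : R => x `^ p.+1%:R) by exact: measurable_powR.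
have pow0 (x : R) : 0 <= x `^ p.+1%:R by exact: powR_ge0.
pose c := fine (moment P Y p.+1%:R).
have Ec : Ex P (fun w => (Y w `^ p.+1%:R)%R) = c%:E by exact: Ex_fin.
have [K K0 HK] := truncation_cvg mpow pow0 Ec e0.
exists K%:R => x Kx.
have x0 : 0 <= x by exact: le_trans Kx.
have mYp : measurable_fun setT (fun w => Y w `^ p.+1%:R).
  exact: (measurableT_comp (@measurable_powR R _) (mX 0%N)).
have xp0 : 0 <= x ^+ p.+1 by exact: exprn_ge0.
rewrite ger0_norm ?mulr_ge0//.
have m1 : measurable_fun setT (fun w => Y w `^ p.+1%:R * (Y w < K%:R)%R%:R).
  exact: measurable_funM.
have m2 : measurable_fun setT (fun w => x ^+ p.+1 * (x <= Y w)%R%:R) by exact: measurable_funM.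
have : (Ex P (fun w => (Y w `^ p.+1%:R * (Y w < K%:R)%R%:R + x ^+ p.+1 * (x <= Y w)%R%:R)%R)
    <= Ex P (fun w => (Y w `^ p.+1%:R)%R))%E.
  apply: Ex_le => //.
  - exact: measurable_funD.
  - by move=> w; rewrite addr_ge0// mulr_ge0.
  - move=> w; case: (ltP (Y w) K%:R) => YK.
      by rewrite [x <= Y w]leNgt (lt_le_trans YK Kx) mulr0 addr0 mulr1.
    rewrite mulr0 add0r; case: (leP x (Y w)) => xY; rewrite ?mulr0// mulr1.
    by rewrite powR_mulrn ?X_ge0// lerXn2r// nnegrE X_ge0.
rewrite ExD//; last 2 first.
- by move=> w; rewrite mulr_ge0.
- by move=> w; rewrite mulr_ge0.
rewrite (@ExZ _ _ _ P (fun w => (x <= Y w)%R%:R))// Et Ec -EFinM => h.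
have := le_trans (leeD HK (lexx _)) h.
by rewrite -EFinD lee_fin; lra.
Qed.

Lemma tail_moment_lty (eta y q s : R) : 0 <= q -> q < s -> 0 <= eta -> 0 < y ->
  (forall x, y <= x -> t x <= eta * x `^ (- s)) -> (Ex P (fun w => (Y w `^ q)%R) < +oo)%E.
Proof.
move=> q0 qs eta0 y0 tl.
have mY : measurable_fun setT Y by exact: mX.
have [K K0 HK] := upper_moment_tail P mY (X_gt0 0%N) q0 qs.
have := HK eta y eta0 y0 _.
move=> /(_ _)/le_lt_trans H.
have fin : (Ex P (fun w => (Y w `^ q * (y <= Y w)%R%:R)%R) < +oo)%E.
  by apply: H; [move=> x yx; rewrite Et lee_fin tl|exact: ltry].
have mYq : measurable_fun setT (fun w => Y w `^ q).
  exact: (measurableT_comp (@measurable_powR R q) mY).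
have mYq1 : measurable_fun setT (fun w => Y w `^ q * (y <= Y w)%R%:R) by exact: measurable_funM.
apply: (@le_lt_trans _ _ (Ex P (fun w => (y `^ q + Y w `^ q * (y <= Y w)%R%:R)%R))).
  apply: Ex_le => //.
  - exact: measurable_funD.
  - by move=> w; exact: powR_ge0.
  - move=> w; case: (leP y (Y w)) => yY; first by rewrite mulr1 lerDr powR_ge0.
    rewrite mulr0 addr0; apply: ge0_ler_powR; rewrite ?nnegrE ?X_ge0 ?(ltW y0)//.
    exact: ltW.
rewrite ExD//; last 2 first.
- by move=> w; exact: powR_ge0.
- by move=> w; rewrite mulr_ge0// powR_ge0.
by rewrite Ex_cst lte_add_pinfty// ltry.
Qed.

(** Only the weaker bound t(x) <= x^(-p-1) for large x is used; it makes every moment of order below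
    p + 1 finite. *)
Lemma otail_moment : otail -> forall q : R, 1 <= q -> q < (p.+1)%:R ->
  (moment P Y q < +oo)%E.
Proof.
move=> /cvg_pinfty0P ot q q1 qp.
have [M HM] := ot _ ltr01.
have tl x : Num.max M 1 <= x -> t x <= 1 * x `^ (- (p%:R + 1 + 0)).
  rewrite ge_max => /andP[Mx x1]; apply: powR_tail => //; first exact: lt_le_trans x1.
  by apply: le_trans (HM x Mx); exact: ler_norm.
apply: (tail_moment_lty _ _ ler01 _ tl); first exact: le_trans q1.
- by rewrite addr0 natr1.
- by rewrite lt_max ltr01 orbT.
Qed.

(** This is the case sig = 1/2. The tail exponent p + 3/2 exceeds 3, so X has a third moment and
    [kap] can be x^2 itself: the lower error is of order 1/n, and n^(-1/2) comes from the upper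
    bound. *)
Lemma Otail_rate :
  (exists C M : R, forall x, M <= x -> t x <= C * x `^ (- (p%:R + 3 / 2))) ->
  exists (C : R) (N : nat), forall n, (N <= n)%N ->
    (`| ETp P X p n - (mu ^+ p)%:E | <= (C / Num.sqrt n%:R)%:E)%E.
Proof.
move=> [C [M tl]].
have sE : p%:R + 3 / 2 = p%:R + 1 + 2^-1 :> R by lra.
pose y := Num.max M 1; pose eta := `|C|.
have eta0 : 0 <= eta by exact: normr_ge0.
have y1 : 1 <= y by rewrite le_max lexx orbT.
have y0 : 0 < y by exact: lt_le_trans y1.
have tl' x : y <= x -> t x <= eta * x `^ (- (p%:R + 1 + 2^-1)).
  rewrite ge_max => /andP[Mx _]; apply: (le_trans (tl x Mx)); rewrite sE.
  by rewrite ler_wpM2r ?powR_ge0// ler_norm.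
have E3 : (Ex P (fun w => (Y w `^ 3)%R) < +oo)%E.
  apply: (tail_moment_lty (ler0n _ 3) _ eta0 y0 tl').
  by have : 2 <= p%:R :> R by [rewrite ler_nat]; lra.
have sq0 (u : R) : 0 <= u ^+ 2 <= u ^+ 2 by rewrite sqr_ge0 lexx.
have ED : Ex P (fun w => (Y w ^+ 2 * Y w)%R) = (fine (Ex P (fun w => (Y w ^+ 2 * Y w)%R)))%:E.
  apply: Ex_fin => [w|]; first by rewrite mulr_ge0 ?sqr_ge0 ?X_ge0.
  rewrite (_ : Ex P _ = Ex P (fun w => (Y w `^ 3)%R))//; apply: eq_Ex => w.
  by rewrite -exprSr powR_mulrn ?X_ge0.
have msq : measurable_fun setT (fun x : R => x ^+ 2) by exact: exprn_measurable.
have [C1 [N1 HN1]] := ETp_lower_eventually msq sq0 EY2 ED.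
have s01 : 0 <= (2^-1 : R) <= 2^-1 by rewrite lexx andbT invr_ge0 ler0n.
have [C2 C20 HC2] := ETp_upper_tail s01.
pose C3 := C2 * (y ^+ (2 * p) + eta).
have yp0 : 0 <= y ^+ (2 * p) by rewrite exprn_ge0// ltW.
have C30 : 0 <= C3 by rewrite mulr_ge0// addr_ge0.
(* The upper bound requires n >= y and an error of at most 1; the latter is C3 / sqrt n <= 1, that
   is n >= C3^2. *)
have [N2 N20 HN2] := exists_nat_ge (y + C3 ^+ 2).
exists (C3 + `|C1|), (maxn N1 N2) => n; rewrite geq_max => /andP[n1 n2].
have nb : y + C3 ^+ 2 <= n%:R by rewrite (le_trans HN2)// ler_nat.
have yn : y <= n%:R by apply: le_trans nb; rewrite lerDl sqr_ge0.
have n0 : 0 < n%:R :> R by exact: lt_le_trans yn.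
have n1' : 1 <= n%:R :> R by exact: le_trans yn.
pose sn := Num.sqrt n%:R : R.
have sn0 : 0 < sn by rewrite sqrtr_gt0.
have sn2 : sn * sn = n%:R by rewrite -expr2 sqr_sqrtr// ltW.
have sn1 : 1 <= sn by rewrite -sqrtr1 ler_wsqrtr.
have snn : n%:R^-1 <= sn^-1.
  by rewrite lef_pV2 ?posrE// -sn2 ler_peMl// ltW.
have powE : n%:R `^ (- 2^-1) = sn^-1 :> R by rewrite powRN powR12_sqrt// ltW.
pose E := y ^+ (2 * p) / n%:R + eta * n%:R `^ (- 2^-1).
have CE : C2 * E <= C3 / sn.
  rewrite /E powE /C3 -mulrA ler_wpM2l// mulrDl lerD2r ler_wpM2l//.
have C3sn : C3 / sn <= 1.
  rewrite ler_pdivrMr// mul1r -(ler_sqr)// ?nnegrE ?(ltW sn0)//.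
  by rewrite [leRHS]expr2 sn2; apply: le_trans nb; rewrite lerDr ltW.
have up := HC2 eta y eta0 y1 tl' n yn (le_trans CE C3sn).
have lo := HN1 n n1.
have t0 : 0 <= c0 * (n%:R ^+ p.+1 * t n%:R).
  by rewrite mulr_ge0 ?(ltW c0_gt0)// mulr_ge0// exprn_ge0// ltW.
have C1n : C1 / n%:R <= `|C1| / sn.
  apply: (@le_trans _ _ (`|C1| / n%:R)); last by rewrite ler_wpM2l.
  by rewrite ler_wpM2r ?ler_norm// invr_ge0 ltW.
have C1sn : 0 <= `|C1| / sn by rewrite divr_ge0// ltW.
have C3sn0 : 0 <= C3 / sn by rewrite divr_ge0// ltW.
rewrite tangent_value in lo.
move: lo up; case: (ETp P X p n) => [r| |]; rewrite ?leye_eq ?leeNy_eq//.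
rewrite !lee_fin => lo up.
rewrite ler_distl -/sn mulrDl.
move: CE; rewrite /E => CE.
by apply/andP; split; lra.
Qed.

End Asymptotics.

Theorem theorem2 (d : measure_display) (T : measurableType d) (R : realType)
  (P : probability T R) (X : nat -> T -> R) (p : nat) :
  (2 <= p)%N ->
  iid P X ->
  (forall n w, 0 < X n w) ->
  (\int[P]_w ((X 0%N w) ^+ 2)%:E < +oo)%E ->
  let mu := ratio_limit P (X 0%N) in
  let conv := (ETp P X p n @[n --> \oo] --> ((mu ^+ p)%:E)) in
  (* (i) convergence <-> P{X >= x} = o(x^{-p-1}) *)
  (conv <->
     (x ^+ p.+1 * tail P (X 0%N) x @[x --> +oo] --> (0 : R)))
  /\
  (* (ii) P{X >= x} = O(x^{-p-3/2}) implies E T_n^p - mu^p = O(n^{-1/2}) *)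
  ((exists C M : R, forall x, M <= x ->
        tail P (X 0%N) x <= C * x `^ (- (p%:R + 3 / 2))) ->
   exists (C : R) (N : nat), forall n, (N <= n)%N ->
        (`| ETp P X p n - (mu ^+ p)%:E | <= (C / Num.sqrt n%:R)%:E)%E)
  /\
  (* (iii) E X^{p+1} < oo is sufficient *)
  ((moment P (X 0%N) (p.+1)%:R < +oo)%E -> conv)
  /\
  (* (iv) convergence implies E X^q < oo for all real 1 <= q < p+1 *)
  (conv -> forall q : R, 1 <= q -> q < (p.+1)%:R ->
        (moment P (X 0%N) q < +oo)%E).
Proof.
move=> p2 iidX X0 EX2 mu conv.
have convo := conv_otail iidX X0 p2 EX2.
have oconv := otail_conv iidX X0 p2 EX2.
split; first by split.
split; first exact: (Otail_rate iidX X0 p2 EX2).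
split; first by move=> /(moment_otail iidX X0) /oconv.
move=> /convo; exact: (otail_moment iidX X0).
Qed.
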